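(* Let $\mathcal{A}$ be a locally finite $k$-linear abelian category and let $\mathcal{C}$ be a Serre subcategory of $\mathcal{A}$. Then the quotient category $\mathcal{A}/\mathcal{C}$ is a locally finite $k$-linear abelian category.
   Context: $k$ is an algebraically closed field. A Serre subcategory of an abelian category $\mathcal{A}$ is a full additive subcategory closed under subobjects, quotients and extensions. The quotient category $\mathcal{A}/\mathcal{C}$ has the same objects as $\mathcal{A}$, and $\mathrm{Hom}_{\mathcal{A}/\mathcal{C}}(M,N)=\varinjlim_{M',N'}\mathrm{Hom}_{\mathcal{A}}(M',N/N')$, where $M'$ and $N'$ run over the subobjects of $M$ and $N$ with $M/M'\in\mathcal{C}$ and $N'\in\mathcal{C}$. By a theorem of Gabriel, $\mathcal{A}/\mathcal{C}$ is abelian and the canonical functor $T:\mathcal{A}\to\mathcal{A}/\mathcal{C}$ is exact. A $k$-linear abelian category is locally finite if all its Hom spaces are finite dimensional over $k$ and every object has finite length. *)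

(* Defs.v *)
From HB Require Import structures.
From mathcomp Require Import all_boot all_algebra.
From mathcomp Require Import generic_quotient.
From mathcomp Require Import boolp.

Set Implicit Arguments.
Unset Strict Implicit.
Unset Printing Implicit Defensive.

Import GRing.Theory.
Local Open Scope ring_scope.

Declare Scope cat_scope.
Delimit Scope cat_scope with cat.
Local Open Scope cat_scope.

Reserved Notation "g \oc f" (at level 40, left associativity).

Record klinear_category (k : fieldType) := KLinearCategory {
  obj :> Type;
  hom : obj -> obj -> lmodType k;
  idm : forall X, hom X X;
  compm : forall X Y Z, hom Y Z -> hom X Y -> hom X Z;
  comp1m : forall X Y (f : hom X Y), compm (idm Y) f = f;
  compm1 : forall X Y (f : hom X Y), compm f (idm X) = f;
  compmA : forall X Y Z W (h : hom Z W) (g : hom Y Z) (f : hom X Y),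
    compm h (compm g f) = compm (compm h g) f;
  compmPl : forall X Y Z (a : k) (g g' : hom Y Z) (f : hom X Y),
    compm (a *: g + g') f = a *: compm g f + compm g' f;
  compmPr : forall X Y Z (a : k) (g : hom Y Z) (f f' : hom X Y),
    compm g (a *: f + f') = a *: compm g f + compm g f' }.

Arguments hom {k} {_} X Y.
Arguments idm {k} {_} X.
Notation "g \oc f" := (compm g f) : cat_scope.

Section Abelian.
Context {k : fieldType} {A : klinear_category k}.
Implicit Types X Y Z W S : A.

Definition mono X Y (i : hom X Y) :=
  forall W (g h : hom W X), i \oc g = i \oc h -> g = h.

Definition epi X Y (p : hom X Y) :=
  forall W (g h : hom Y W), g \oc p = h \oc p -> g = h.

Definition iso X Y (f : hom X Y) :=
  exists g : hom Y X, g \oc f = idm X /\ f \oc g = idm Y.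

Definition is_zero Z :=
  forall X, (forall f : hom X Z, f = 0) /\ (forall f : hom Z X, f = 0).

Record is_biproduct X Y P (i1 : hom X P) (i2 : hom Y P)
    (p1 : hom P X) (p2 : hom P Y) : Prop := IsBiproduct {
  biprod11 : p1 \oc i1 = idm X;
  biprod22 : p2 \oc i2 = idm Y;
  biprod12 : p1 \oc i2 = 0;
  biprod21 : p2 \oc i1 = 0;
  biprodE : i1 \oc p1 + i2 \oc p2 = idm P }.

Definition is_kernel X Y K (f : hom X Y) (i : hom K X) :=
  f \oc i = 0 /\
  forall W (g : hom W X), f \oc g = 0 -> exists! h : hom W K, i \oc h = g.

Definition is_cokernel X Y Q (f : hom X Y) (p : hom Y Q) :=
  p \oc f = 0 /\
  forall W (g : hom Y W), g \oc f = 0 -> exists! h : hom Q W, h \oc p = g.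

(* 0 -> X -> Y -> Z -> 0 *)
Definition short_exact X Y Z (i : hom X Y) (p : hom Y Z) :=
  is_kernel p i /\ is_cokernel i p.

Definition simple S :=
  ~ is_zero S /\ forall Y (i : hom Y S), mono i -> is_zero Y \/ iso i.

(* Existence of a finite composition series, built from its bottom upwards. *)
Inductive finite_length : A -> Prop :=
| FiniteLength0 Z : is_zero Z -> finite_length Z
| FiniteLengthS X Y S (i : hom X Y) (p : hom Y S) :
    short_exact i p -> simple S -> finite_length X -> finite_length Y.

End Abelian.

Record abelian {k : fieldType} (A : klinear_category k) : Prop := IsAbelian {
  ab_zero : exists Z : A, is_zero Z;
  ab_biproduct : forall X Y : A,
    exists P (i1 : hom X P) (i2 : hom Y P) (p1 : hom P X) (p2 : hom P Y),
      is_biproduct i1 i2 p1 p2;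
  ab_kernel : forall (X Y : A) (f : hom X Y),
    exists K (i : hom K X), is_kernel f i;
  ab_cokernel : forall (X Y : A) (f : hom X Y),
    exists Q (p : hom Y Q), is_cokernel f p;
  ab_mono : forall (X Y : A) (i : hom X Y), mono i ->
    exists Z (f : hom Y Z), is_kernel f i;
  ab_epi : forall (X Y : A) (p : hom X Y), epi p ->
    exists Z (f : hom Z X), is_cokernel f p }.

Definition finite_dimensional {k : fieldType} (V : lmodType k) :=
  exists n (phi : {linear V -> 'rV[k]_n}), bijective phi.

Record locally_finite {k : fieldType} (A : klinear_category k) : Prop :=
  IsLocallyFinite {
    lf_hom : forall X Y : A, finite_dimensional (@hom k A X Y);
    lf_length : forall X : A, finite_length X }.

(* A full subcategory is given by its class of objects. *)
Record serre {k : fieldType} (A : klinear_category k) (C : A -> Prop) : Prop :=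
  IsSerre {
    serre_zero : forall Z, is_zero Z -> C Z;
    serre_biprod : forall X Y P (i1 : hom X P) (i2 : hom Y P)
        (p1 : hom P X) (p2 : hom P Y),
      is_biproduct i1 i2 p1 p2 -> C X -> C Y -> C P;
    serre_sub : forall X Y (i : hom X Y), mono i -> C Y -> C X;
    serre_quo : forall X Y (p : hom X Y), epi p -> C X -> C Y;
    serre_ext : forall X Y Z (i : hom X Y) (p : hom Y Z),
      short_exact i p -> C X -> C Z -> C Y }.

Section Linearity.
Context {k : fieldType} {A : klinear_category k}.
Implicit Types X Y Z : A.

Lemma compmDl X Y Z (g g' : hom Y Z) (f : hom X Y) :
  (g + g') \oc f = g \oc f + g' \oc f.
Proof. by have := compmPl 1 g g' f; rewrite !scale1r. Qed.

Lemma compmDr X Y Z (g : hom Y Z) (f f' : hom X Y) :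
  g \oc (f + f') = g \oc f + g \oc f'.
Proof. by have := compmPr 1 g f f'; rewrite !scale1r. Qed.

Lemma comp0m X Y Z (f : hom X Y) : (0 : hom Y Z) \oc f = 0.
Proof. by apply: (addrI (0 \oc f)); rewrite -compmDl !addr0. Qed.

Lemma compm0 X Y Z (g : hom Y Z) : g \oc (0 : hom X Y) = 0.
Proof. by apply: (addrI (g \oc 0)); rewrite -compmDr !addr0. Qed.

Lemma compmNl X Y Z (g : hom Y Z) (f : hom X Y) : (- g) \oc f = - (g \oc f).
Proof. by apply: (addrI (g \oc f)); rewrite -compmDl !subrr comp0m. Qed.

Lemma compmNr X Y Z (g : hom Y Z) (f : hom X Y) : g \oc (- f) = - (g \oc f).
Proof. by apply: (addrI (g \oc f)); rewrite -compmDr !subrr compm0. Qed.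

Lemma compmBl X Y Z (g g' : hom Y Z) (f : hom X Y) :
  (g - g') \oc f = g \oc f - g' \oc f.
Proof. by rewrite compmDl compmNl. Qed.

Lemma compmBr X Y Z (g : hom Y Z) (f f' : hom X Y) :
  g \oc (f - f') = g \oc f - g \oc f'.
Proof. by rewrite compmDr compmNr. Qed.

Lemma compmZl X Y Z (a : k) (g : hom Y Z) (f : hom X Y) :
  (a *: g) \oc f = a *: (g \oc f).
Proof. by rewrite -[a *: g]addr0 compmPl comp0m addr0. Qed.

Lemma compmZr X Y Z (a : k) (g : hom Y Z) (f : hom X Y) :
  g \oc (a *: f) = a *: (g \oc f).
Proof. by rewrite -[a *: f]addr0 compmPr compm0 addr0. Qed.

Lemma monoP X Y (i : hom X Y) :
  (forall W (g : hom W X), i \oc g = 0 -> g = 0) -> mono i.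
Proof.
move=> i0 W g h e; apply/eqP; rewrite -subr_eq0; apply/eqP/i0.
by rewrite compmBr e subrr.
Qed.

Lemma epiP X Y (p : hom X Y) :
  (forall W (g : hom Y W), g \oc p = 0 -> g = 0) -> epi p.
Proof.
move=> p0 W g h e; apply/eqP; rewrite -subr_eq0; apply/eqP/p0.
by rewrite compmBl e subrr.
Qed.

Lemma mono0 X Y W (i : hom X Y) (g : hom W X) : mono i -> i \oc g = 0 -> g = 0.
Proof. by move=> mi e; apply: mi; rewrite e compm0. Qed.

Lemma epi0 X Y W (p : hom X Y) (g : hom Y W) : epi p -> g \oc p = 0 -> g = 0.
Proof. by move=> ep e; apply: ep; rewrite e comp0m. Qed.

Lemma mono_comp X Y Z (g : hom Y Z) (f : hom X Y) :
  mono g -> mono f -> mono (g \oc f).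
Proof. by move=> mg mf W u v; rewrite -!compmA => /mg /mf. Qed.

Lemma epi_comp X Y Z (g : hom Y Z) (f : hom X Y) :
  epi g -> epi f -> epi (g \oc f).
Proof. by move=> eg ef W u v; rewrite !compmA => /ef /eg. Qed.

Lemma epi_compr X Y Z (g : hom Y Z) (f : hom X Y) : epi (g \oc f) -> epi g.
Proof. by move=> e W u v h; apply: e; rewrite !compmA h. Qed.

Lemma mono_compl X Y Z (g : hom Y Z) (f : hom X Y) : mono (g \oc f) -> mono f.
Proof. by move=> e W u v h; apply: e; rewrite -!compmA h. Qed.

Lemma idm_epi X : epi (idm X).
Proof. by move=> W g h; rewrite !compm1. Qed.

Lemma ker_mono X Y K (f : hom X Y) (i : hom K X) : is_kernel f i -> mono i.
Proof.
move=> [fi0 u]; apply: monoP => W g e.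
have [h [_ hU]] := u W 0 (compm0 _ f).
by rewrite -(hU g e) (hU 0) // compm0.
Qed.

Lemma coker_epi X Y Q (f : hom X Y) (p : hom Y Q) : is_cokernel f p -> epi p.
Proof.
move=> [fi0 u]; apply: epiP => W g e.
have [h [_ hU]] := u W 0 (comp0m _ f).
by rewrite -(hU g e) (hU 0) // comp0m.
Qed.

Lemma ker_fact X Y K W (f : hom X Y) (i : hom K X) (g : hom W X) :
  is_kernel f i -> f \oc g = 0 -> exists h, g = i \oc h.
Proof. by move=> [_ u] /u [h [<- _]]; exists h. Qed.

Lemma coker_fact X Y Q W (f : hom X Y) (p : hom Y Q) (g : hom Y W) :
  is_cokernel f p -> g \oc f = 0 -> exists h, g = h \oc p.
Proof. by move=> [_ u] /u [h [<- _]]; exists h. Qed.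

Lemma kerI X Y K (f : hom X Y) (i : hom K X) : mono i -> f \oc i = 0 ->
  (forall W (g : hom W X), f \oc g = 0 -> exists h, g = i \oc h) -> is_kernel f i.
Proof.
move=> mi fi u; split=> // W g /u [h ->]; exists h; split=> // h' /mi.
by move=> ->.
Qed.

Lemma cokerI X Y Q (f : hom X Y) (p : hom Y Q) : epi p -> p \oc f = 0 ->
  (forall W (g : hom Y W), g \oc f = 0 -> exists h, g = h \oc p) ->
  is_cokernel f p.
Proof.
move=> mi fi u; split=> // W g /u [h ->]; exists h; split=> // h' /mi.
by move=> ->.
Qed.

End Linearity.

Section AbelianTheory.
Context {k : fieldType} {A : klinear_category k} (hA : abelian A).
Implicit Types X Y Z W : A.

Lemma epi_coker X Y K (p : hom X Y) (i : hom K X) :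
  epi p -> is_kernel p i -> is_cokernel i p.
Proof.
move=> ep ki; have [Z [f cf]] := ab_epi hA ep.
have [f' Ef] := ker_fact ki cf.1.
apply: cokerI => //; first exact: ki.1.
by move=> W g gi; apply: (coker_fact cf); rewrite Ef compmA gi comp0m.
Qed.

Lemma mono_ker X Y Q (i : hom X Y) (p : hom Y Q) :
  mono i -> is_cokernel i p -> is_kernel p i.
Proof.
move=> mi cp; have [Z [f kf]] := ab_mono hA mi.
have [f' Ef] := coker_fact cp kf.1.
apply: kerI => //; first exact: cp.1.
by move=> W g pg; apply: (ker_fact kf); rewrite Ef -compmA pg compm0.
Qed.

Lemma image_fact X Y (s : hom X Y) :
  exists I (e : hom X I) (i : hom I Y) Q (q : hom Y Q),
  [/\ epi e, s = i \oc e, is_cokernel s q & short_exact i q].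
Proof.
have [Q [q cq]] := ab_cokernel hA s; have [I [i ki]] := ab_kernel hA q.
have [e Es] := ker_fact ki cq.1; exists I, e, i, Q, q.
have eq := coker_epi cq; have mi := ker_mono ki.
split=> //; last by split; [|apply: epi_coker].
apply: epiP => W w we; have [J [l kl]] := ab_kernel hA w.
have [e' Ee] := ker_fact kl we.
have mil : mono (i \oc l) by apply: mono_comp => //; apply: ker_mono kl.
have [R [c cc]] := ab_cokernel hA (i \oc l).
have kc := mono_ker mil cc.
have [c' Ec] : exists c', c = c' \oc q.
  apply: (coker_fact cq).
  by rewrite Es Ee [i \oc _]compmA compmA kc.1 comp0m.
have [r Er] : exists r, i = (i \oc l) \oc r.
  by apply: (ker_fact kc); rewrite Ec -compmA ki.1 compm0.
have lr : l \oc r = idm I by apply: mi; rewrite compm1 compmA -Er.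
by rewrite -[w]compm1 -lr compmA kl.1 comp0m.
Qed.

Lemma pullback_epi X Y Z (p : hom X Z) (g : hom Y Z) : epi p ->
  exists P (q : hom P Y) (h : hom P X),
  [/\ epi q, p \oc h = g \oc q &
    forall W (a : hom W X) (b : hom W Y), p \oc a = g \oc b ->
      exists t, a = h \oc t /\ b = q \oc t].
Proof.
move=> ep; have [B [i1 [i2 [p1 [p2 [b11 b22 b12 b21 bE]]]]]] := ab_biproduct hA X Y.
pose d := p \oc p1 - g \oc p2.
have di1 : d \oc i1 = p by rewrite compmBl -!compmA b11 b21 compm1 compm0 subr0.
have ed : epi d by apply: (epi_compr (f := i1)); rewrite di1.
have [P [j kj]] := ab_kernel hA d.
have cd := epi_coker ed kj.
exists P, (p2 \oc j), (p1 \oc j); split.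
- apply: epiP => W w; rewrite compmA => w0.
  have [w' Ew] := coker_fact cd w0.
  have w'0 : w' = 0.
    by apply: (epi0 ep); rewrite -di1 compmA -Ew -compmA b21 compm0.
  by rewrite -[w]compm1 -b22 compmA Ew w'0 !comp0m.
- by apply/eqP; rewrite -subr_eq0 !compmA -compmBl; apply/eqP/kj.1.
- move=> W a b e; have [|t Et] := ker_fact (g := i1 \oc a + i2 \oc b) kj.
    rewrite compmDr compmBl compmBl -!compmA.
    rewrite [p1 \oc (i1 \oc a)]compmA [p2 \oc (i1 \oc a)]compmA.
    rewrite [p1 \oc (i2 \oc b)]compmA [p2 \oc (i2 \oc b)]compmA.
    by rewrite b11 b21 b12 b22 !comp1m !comp0m !compm0 subr0 sub0r e subrr.
  exists t; rewrite -!compmA -Et !compmDr !compmA.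
  by rewrite b11 b21 b12 b22 !comp1m !comp0m addr0 add0r.
Qed.

End AbelianTheory.

Section SerreQuotient.
Context {k : fieldType} {A : klinear_category k} (C : A -> Prop).

(* A subobject of M, together with the quotient of M by it. *)
Record subobject (M : A) := Subobject {
  so_obj : A;
  so_quo : A;
  so_in : hom so_obj M;
  so_pr : hom M so_quo;
  so_exact : short_exact so_in so_pr }.

(* A pair (M', N') with M / M' and N' in C. *)
Record qindex (M N : A) := QIndex {
  qi_sub : subobject M;
  qi_ker : subobject N;
  qi_subC : C (so_quo qi_sub);
  qi_kerC : C (so_obj qi_ker) }.

Definition qi_src M N (i : qindex M N) := so_obj (qi_sub i).
Definition qi_tgt M N (i : qindex M N) := so_quo (qi_ker i).
Definition qi_in M N (i : qindex M N) : hom (qi_src i) M := so_in (qi_sub i).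
Definition qi_pr M N (i : qindex M N) : hom N (qi_tgt i) := so_pr (qi_ker i).

(* An element of Hom_A(M', N / N') for some index (M', N'). *)
Record frac (M N : A) := Frac {
  fr_idx :> qindex M N;
  fr_map : hom (qi_src fr_idx) (qi_tgt fr_idx) }.

(* g is the image of f under the transition map
   Hom_A(M', N / N') -> Hom_A(M'', N / N'') for M'' <= M' and N' <= N''. *)
Definition frac_le M N (f g : frac M N) :=
  exists (u : hom (qi_src g) (qi_src f)) (v : hom (qi_tgt f) (qi_tgt g)),
    [/\ qi_in f \oc u = qi_in g, v \oc qi_pr f = qi_pr g &
        fr_map g = v \oc fr_map f \oc u].

(* Equality in the filtered colimit. *)
Definition frac_eqv M N (f g : frac M N) :=
  exists h, frac_le f h /\ frac_le g h.

(* For a generalized element s of M and y of N: s lies in M' and f maps it to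
   the class of y in N / N'. *)
Definition graph M N (f : frac M N) X (s : hom X M) (y : hom X N) :=
  exists u : hom X (qi_src f), qi_in f \oc u = s /\ fr_map f \oc u = qi_pr f \oc y.

(* h : M'' -> P / P'' represents the composite of f : M' -> N / N' and
   g : N'' -> P / P' when every m in M'' (lifted along an epimorphism x) lies in
   M' and there are n in N'' and p in P such that f m = n mod N',
   g n = p mod P' and h m = p mod P''. *)
Definition is_composite M N P (g : frac N P) (f : frac M N) (h : frac M P) :=
  exists X (x : hom X (qi_src h)) (y : hom X N) (z : hom X P),
    [/\ epi x, graph f (qi_in h \oc x) y, graph g y z
      & fr_map h \oc x = qi_pr h \oc z].

Context (hA : abelian A) (hC : serre C).
Implicit Types X Y Z W M N P : A.

(* Equivalently, the cokernel of s is in C. *)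
Definition cepi (X Y : A) (s : hom X Y) :=
  forall W (w : hom Y W), epi w -> w \oc s = 0 -> C W.

(* Equivalently, the kernel of s is in C. *)
Definition cmono (X Y : A) (s : hom X Y) :=
  forall W (w : hom W X), mono w -> s \oc w = 0 -> C W.

Lemma zero_id0 X : idm X = 0 -> is_zero X.
Proof.
move=> e Y; split=> f; first by rewrite -[f]comp1m e comp0m.
by rewrite -[f]compm1 e compm0.
Qed.

Lemma epi_cepi X Y (s : hom X Y) : epi s -> cepi s.
Proof.
move=> es W w ew ws; apply: (serre_zero hC); apply: zero_id0.
by apply: ew; rewrite (epi0 es ws) !compm0.
Qed.

Lemma mono_cmono X Y (s : hom X Y) : mono s -> cmono s.
Proof.
move=> es W w ew ws; apply: (serre_zero hC); apply: zero_id0.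
by apply: ew; rewrite (mono0 es ws) !comp0m.
Qed.

Lemma cepi_comp X Y Z (s : hom Y Z) (t : hom X Y) : cepi s -> cepi t -> cepi (s \oc t).
Proof.
move=> cs ct W w ew wst.
have [I [e [i [Q [q [ee E cq ses]]]]]] := image_fact hA (w \oc s).
apply: (serre_ext hC ses).
  apply: (ct _ e ee); apply: (mono0 (ker_mono ses.1)).
  by rewrite compmA -E -compmA.
apply: (cs _ (q \oc w)); first exact: (epi_comp (coker_epi cq) ew).
by rewrite -compmA cq.1.
Qed.

Lemma cmono_comp X Y Z (s : hom Y Z) (t : hom X Y) :
  cmono s -> cmono t -> cmono (s \oc t).
Proof.
move=> cs ct W w mw stw.
have [I [e [i [Q [q [ee E _ ses]]]]]] := image_fact hA (t \oc w).
have [V [v kv]] := ab_kernel hA e.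
have ces := epi_coker hA ee kv.
have mi := ker_mono ses.1.
apply: (serre_ext hC (conj kv ces)).
  apply: (ct _ (w \oc v)); first exact: (mono_comp mw (ker_mono kv)).
  by rewrite compmA E -compmA kv.1 compm0.
apply: (cs _ i mi); apply: (epi0 ee).
by rewrite -compmA -E compmA.
Qed.

Lemma kerC_cepi X Y K (f : hom X Y) (j : hom K X) : C Y -> is_kernel f j -> cepi j.
Proof.
move=> CY kj W w ew wj.
have [I [e [i [Q [q [ee E cq ses]]]]]] := image_fact hA f.
have mi := ker_mono ses.1.
have ke : is_kernel e j.
  apply: kerI; first exact: (ker_mono kj).
    by apply: (mono0 mi); rewrite compmA -E kj.1.
  by move=> V g eg; apply: (ker_fact kj); rewrite E -compmA eg compm0.
have [w' Ew] := coker_fact (epi_coker hA ee ke) wj.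
apply: (serre_quo hC (p := w')); first by rewrite Ew in ew; exact: (epi_compr ew).
exact: (serre_sub hC mi CY).
Qed.

Lemma cokerC_cmono X Y Q (f : hom X Y) (p : hom Y Q) : C X -> is_cokernel f p -> cmono p.
Proof.
move=> CX cp W w mw pw.
have [I [e [i [R [q [ee E cq ses]]]]]] := image_fact hA f.
have kp : is_kernel p i.
  apply: (mono_ker hA (ker_mono ses.1)); apply: cokerI; first exact: (coker_epi cp).
    by apply: (epi0 ee); rewrite -compmA -E cp.1.
  by move=> V g gi; apply: (coker_fact cp); rewrite E compmA gi comp0m.
have [w' Ew] := ker_fact kp pw.
apply: (serre_sub hC (i := w')); first by rewrite Ew in mw; exact: (mono_compl mw).
exact: (serre_quo hC ee CX).
Qed.

Lemma ses_cepi X Y Z (i : hom X Y) (p : hom Y Z) : short_exact i p -> C Z -> cepi i.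
Proof. by move=> [ki _] CZ; apply: (kerC_cepi _ ki). Qed.

Lemma ses_cmono X Y Z (i : hom X Y) (p : hom Y Z) : short_exact i p -> C X -> cmono p.
Proof. by move=> [_ ki] CZ; apply: (cokerC_cmono _ ki). Qed.

Lemma ore X Y Z (s : hom X Y) (f : hom Z Y) : cepi s ->
  exists W (t : hom W Z) (x : hom W X), cepi t /\ f \oc t = s \oc x.
Proof.
move=> cs; have [I [e [i [Q [q [ee E cq ses]]]]]] := image_fact hA s.
have CQ : C Q by apply: (cs _ q (coker_epi cq) cq.1).
have [Z' [j kj]] := ab_kernel hA (q \oc f).
have [g Eg] : exists g, f \oc j = i \oc g.
  by apply: (ker_fact ses.1); rewrite compmA kj.1.
have [W [t [x [et Et _]]]] := pullback_epi hA g ee.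
exists W, (j \oc t), x; split.
  by apply: cepi_comp; [apply: (kerC_cepi _ kj)|apply: epi_cepi].
by rewrite compmA Eg E -!compmA Et.
Qed.

Lemma nullC X Y Z W (i : hom X Y) (p : hom Y Z) (y : hom W Y) :
  short_exact i p -> C X -> p \oc y = 0 ->
  exists V (t : hom V W), cepi t /\ y \oc t = 0.
Proof.
move=> ses CX py; have [y' Ey] := ker_fact ses.1 py.
have [V [t kt]] := ab_kernel hA y'; exists V, t; split; first exact: (kerC_cepi _ kt).
by rewrite Ey -compmA kt.1 compm0.
Qed.

Lemma qi_in_cepi M N (i : qindex M N) : cepi (qi_in i).
Proof. by apply: ses_cepi (so_exact _) (qi_subC _). Qed.

Lemma qi_in_mono M N (i : qindex M N) : mono (qi_in i).
Proof. exact: ker_mono (so_exact _).1. Qed.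

Lemma qi_pr_cmono M N (i : qindex M N) : cmono (qi_pr i).
Proof. by apply: ses_cmono (so_exact _) (qi_kerC _). Qed.

Lemma qi_pr_epi M N (i : qindex M N) : epi (qi_pr i).
Proof. exact: coker_epi (so_exact _).2. Qed.

Lemma qi_null M N (i : qindex M N) W (y : hom W N) : qi_pr i \oc y = 0 ->
  exists V (t : hom V W), cepi t /\ y \oc t = 0.
Proof. by apply: nullC (so_exact _) (qi_kerC _). Qed.

Lemma graph_comp M N (f : frac M N) X Y (s : hom X M) (y : hom X N) (t : hom Y X) :
  graph f s y -> graph f (s \oc t) (y \oc t).
Proof.
by move=> [u [<- e]]; exists (u \oc t); rewrite !compmA e.
Qed.

Lemma frac_le_refl M N (f : frac M N) : frac_le f f.
Proof. by exists (idm _), (idm _); rewrite !comp1m !compm1. Qed.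

Lemma graph_le M N (f h : frac M N) X (s : hom X M) (y : hom X N) :
  frac_le f h -> graph f s y ->
  exists Y (t : hom Y X), cepi t /\ graph h (s \oc t) (y \oc t).
Proof.
move=> [u [v [Eu Ev Eh]]] [w [Ew E]].
have [Y [t [b [ct Eb]]]] := ore s (@qi_in_cepi _ _ h).
exists Y, t; split=> //; exists b; split=> //.
rewrite Eh -Ev -compmA.
have -> : u \oc b = w \oc t.
  by apply: (@qi_in_mono _ _ f); rewrite !compmA Eu -Eb Ew.
by rewrite -!compmA [fr_map f \oc _]compmA E -!compmA.
Qed.

Lemma graph_ge M N (f h : frac M N) X (s : hom X M) (y : hom X N) :
  frac_le f h -> graph h s y ->
  exists Y (t : hom Y X), cepi t /\ graph f (s \oc t) (y \oc t).
Proof.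
move=> [u [v [Eu Ev Eh]]] [w [Ew E]].
pose d := fr_map f \oc (u \oc w) - qi_pr f \oc y.
have vd : v \oc d = 0.
  by rewrite compmBr [v \oc (qi_pr f \oc y)]compmA Ev -E Eh -!compmA subrr.
have [X' [x [d' [ex Ed _]]]] := pullback_epi hA d (@qi_pr_epi _ _ f).
have : qi_pr h \oc d' = 0 by rewrite -Ev -compmA Ed compmA vd comp0m.
case/qi_null=> V [t [ct d't]].
exists V, (x \oc t); split.
  by apply: cepi_comp => //; apply: epi_cepi.
exists (u \oc w \oc (x \oc t)); split; first by rewrite !compmA Eu Ew.
apply/eqP; rewrite -subr_eq0 !compmA -!compmBl -/d; apply/eqP.
rewrite -compmA -[fr_map f \oc u \oc w]compmA -/d compmA -Ed -compmA d't.
by rewrite compm0.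
Qed.

(* The closure of graph f under restriction along maps t with cokernel in C.
   Unlike graph f, it only depends on the class of f in the colimit, which it
   determines (germ_eqv, germ_eqv_conv); the laws of A / C are proved with it. *)
Definition germ M N (f : frac M N) X (s : hom X M) (y : hom X N) :=
  exists Y (t : hom Y X), cepi t /\ graph f (s \oc t) (y \oc t).

Lemma graph_germ M N (f : frac M N) X (s : hom X M) (y : hom X N) :
  graph f s y -> germ f s y.
Proof.
move=> g; exists X, (idm X); rewrite !compm1; split=> //.
by apply/epi_cepi/idm_epi.
Qed.

Lemma germ_local M N (f : frac M N) X Y (s : hom X M) (y : hom X N) (t : hom Y X) :
  cepi t -> germ f (s \oc t) (y \oc t) -> germ f s y.
Proof.
move=> ct [Z [t' [ct' g]]]; exists Z, (t \oc t'); rewrite !compmA; split=> //.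
exact: cepi_comp.
Qed.

Lemma germ_eqv M N (f g : frac M N) X (s : hom X M) (y : hom X N) :
  frac_eqv f g -> germ f s y -> germ g s y.
Proof.
move=> [h [fh gh]] [Y [t [ct /(graph_le fh)[Z [t' [ct']]]]]].
case/(graph_ge gh) => W [t'' [ct'' gr]].
by apply: (germ_local ct); apply: (germ_local ct'); exists W, t''.
Qed.

Lemma germ_comp M N (f : frac M N) X Y (s : hom X M) (y : hom X N) (t : hom Y X) :
  germ f s y -> germ f (s \oc t) (y \oc t).
Proof.
move=> [Z [r [cr g]]]; have [W [a [b [ca E]]]] := ore t cr.
exists W, a; split=> //; rewrite -!compmA E !compmA; exact: graph_comp.
Qed.

Lemma graph_total M N (f : frac M N) X (s : hom X M) :
  exists Y (t : hom Y X) (y : hom Y N), cepi t /\ graph f (s \oc t) y.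
Proof.
have [Z [r [b [cr Eb]]]] := ore s (@qi_in_cepi _ _ f).
have [Y [t [y [et Ey _]]]] := pullback_epi hA (fr_map f \oc b) (@qi_pr_epi _ _ f).
exists Y, (r \oc t), y; split; first by apply: cepi_comp => //; apply: epi_cepi.
by exists (b \oc t); rewrite !compmA Eb Ey.
Qed.

Lemma graph_fun0 M N (f : frac M N) X (s : hom X M) (y y' : hom X N) :
  graph f s y -> graph f s y' -> exists Y (t : hom Y X), cepi t /\ y \oc t = y' \oc t.
Proof.
move=> [u [Eu E]] [u' [Eu' E']].
have Euu : u = u' by apply: (@qi_in_mono _ _ f); rewrite Eu.
rewrite -Euu in E'.
have [|Y [t [ct e]]] := qi_null (i := f) (y := y - y').
  by rewrite compmBr -E -E' subrr.
by exists Y, t; split=> //; apply/eqP; rewrite -subr_eq0 -compmBl e.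
Qed.

Lemma germ_fun M N (f : frac M N) X (s : hom X M) (y y' : hom X N) :
  germ f s y -> germ f s y' -> exists Y (t : hom Y X), cepi t /\ y \oc t = y' \oc t.
Proof.
move=> [Y [t [ct g]]] [Y' [t' [ct' g']]].
have [W [a [b [ca E]]]] := ore t ct'.
have gy := graph_comp a g; have gy' := graph_comp b g'.
rewrite -!compmA in gy gy'; rewrite E in gy.
have [V [c [cc Ec]]] := graph_fun0 gy gy'.
exists V, (t \oc a \oc c); split; first by do 2!apply: cepi_comp => //.
by rewrite E compmA Ec -compmA.
Qed.

Lemma image_sub X M (s : hom X M) : exists (D : subobject M) (e : hom X (so_obj D)),
  [/\ epi e, s = so_in D \oc e & is_cokernel s (so_pr D)].
Proof.
have [I [e [i [Q [q [ee E cq ses]]]]]] := image_fact hA s.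
by exists (Subobject ses), e.
Qed.

Lemma kernel_sub M Y (q : hom M Y) : exists (D : subobject M) (m : hom (so_quo D) Y),
  [/\ mono m, q = m \oc so_pr D & is_kernel q (so_in D)].
Proof.
have [I [e [i [Q [r [ee E cq ses]]]]]] := image_fact hA q.
have [K [j kj]] := ab_kernel hA q; have mi := ker_mono ses.1.
have ke : is_kernel e j.
  apply: kerI; first exact: (ker_mono kj).
    by apply: (mono0 mi); rewrite compmA -E kj.1.
  by move=> V g eg; apply: (ker_fact kj); rewrite E -compmA eg compm0.
by exists (Subobject (conj ke (epi_coker hA ee ke))), i.
Qed.

Lemma quotient_sub M Y (q : hom M Y) : epi q -> exists (D : subobject M)
    (a : hom (so_quo D) Y) (b : hom Y (so_quo D)),
  [/\ a \oc so_pr D = q, b \oc q = so_pr D & is_kernel q (so_in D)].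
Proof.
move=> eq; have [D [m [mm E kD]]] := kernel_sub q.
have [|b Eb] := coker_fact (g := so_pr D) (epi_coker hA eq kD).
  by rewrite (so_exact D).1.1.
by exists D, m, b.
Qed.

Lemma sub_meet M (D1 D2 : subobject M) : C (so_quo D1) -> C (so_quo D2) ->
  exists D : subobject M, [/\ C (so_quo D),
    exists u, so_in D1 \oc u = so_in D & exists u, so_in D2 \oc u = so_in D].
Proof.
move=> C1 C2.
have [B [i1 [i2 [p1 [p2 bp]]]]] := ab_biproduct hA (so_quo D1) (so_quo D2).
have [b11 b22 b12 b21 bE] := bp.
have [D [m [mm E [kD _]]]] := kernel_sub (i1 \oc so_pr D1 + i2 \oc so_pr D2).
exists D; split; first exact: (serre_sub hC mm (serre_biprod hC bp C1 C2)).
- have [|u ->] := ker_fact (g := so_in D) (so_exact D1).1; last by exists u.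
  have := congr1 (compm p1) kD; rewrite compmDl !compmDr !compmA b11 b12 compm0.
  by rewrite comp1m !comp0m addr0.
- have [|u ->] := ker_fact (g := so_in D) (so_exact D2).1; last by exists u.
  have := congr1 (compm p2) kD; rewrite compmDl !compmDr !compmA b22 b21 compm0.
  by rewrite comp1m !comp0m add0r.
Qed.

Lemma sub_join M (D1 D2 : subobject M) : C (so_obj D1) -> C (so_obj D2) ->
  exists D : subobject M, [/\ C (so_obj D),
    exists v, v \oc so_pr D1 = so_pr D & exists v, v \oc so_pr D2 = so_pr D].
Proof.
move=> C1 C2.
have [B [i1 [i2 [p1 [p2 bp]]]]] := ab_biproduct hA (so_obj D1) (so_obj D2).
have [b11 b22 b12 b21 bE] := bp.
have [D [m [mm E [kD _]]]] := image_sub (so_in D1 \oc p1 + so_in D2 \oc p2).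
exists D; split; first exact: (serre_quo hC mm (serre_biprod hC bp C1 C2)).
- have [|u ->] := coker_fact (g := so_pr D) (so_exact D1).2; last by exists u.
  have /= := congr1 (fun w => w \oc i1) kD; rewrite compmDr !compmDl -!compmA b11 b21.
  by rewrite compm1 !compm0 comp0m addr0.
- have [|u ->] := coker_fact (g := so_pr D) (so_exact D2).2; last by exists u.
  have /= := congr1 (fun w => w \oc i2) kD; rewrite compmDr !compmDl -!compmA b22 b12.
  by rewrite compm1 !compm0 comp0m add0r.
Qed.

Lemma frac_make X M N (s : hom X M) (y : hom X N) (K : subobject N) :
  cepi s -> C (so_obj K) ->
  (forall Y (t : hom Y X), s \oc t = 0 -> so_pr K \oc (y \oc t) = 0) ->
  exists (h : frac M N) (x : hom X (qi_src h)),
    [/\ epi x, qi_in h \oc x = s & fr_map h \oc x = qi_pr h \oc y].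
Proof.
move=> cs CK sy; have [D [e [ee E cD]]] := image_sub s.
have CD : C (so_quo D) by apply: (cs _ _ (coker_epi cD) cD.1).
have [L [l kl]] := ab_kernel hA e.
have [|h Eh] := coker_fact (g := so_pr K \oc y) (epi_coker hA ee kl).
  by rewrite -compmA; apply: sy; rewrite E -compmA kl.1 compm0.
by exists (@Frac M N (QIndex CD CK) h), e.
Qed.

Lemma germ_eqv_conv M N (f g : frac M N) X (s : hom X M) (y : hom X N) :
  cepi s -> germ f s y -> germ g s y -> frac_eqv f g.
Proof.
move=> cs [Y [t [ct gf]]] /(germ_comp t) [Z [t' [ct' gg]]].
have {gf} := graph_comp t' gf; move: gg.
rewrite -!compmA; move: (t \oc t') (cepi_comp ct ct') => r cr.
have csr : cepi (s \oc r) by apply: cepi_comp.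
move: (s \oc r) (y \oc r) csr => {r cr}{}s {}y {}cs.
move=> [ug [Eug Eg]] [uf [Euf Ef]].
have [D [e [ee E cD]]] := image_sub s.
have CD : C (so_quo D) by apply: (cs _ _ (coker_epi cD) cD.1).
have [K [CK [vf Evf] [vg Evg]]] := sub_join (qi_kerC f) (qi_kerC g).
have lift (h : frac M N) w : qi_in h \oc w = s ->
    exists u, qi_in h \oc u = so_in D.
  move=> Ew; have [|u Eu] := ker_fact (g := so_in D) (so_exact (qi_sub h)).1.
    by apply: (epi0 ee); rewrite -compmA -E -Ew compmA (so_exact _).1.1 comp0m.
  by exists u.
have [u1 Eu1] := lift _ _ Euf; have [u2 Eu2] := lift _ _ Eug.
have lift2 (h : frac M N) w u v : qi_in h \oc w = s -> qi_in h \oc u = so_in D ->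
    v \oc qi_pr h = so_pr K -> fr_map h \oc w = qi_pr h \oc y ->
    v \oc fr_map h \oc u \oc e = so_pr K \oc y.
  move=> Ew Eu Ev Eh; rewrite -!compmA.
  have -> : u \oc e = w by apply: (@qi_in_mono _ _ h); rewrite compmA Eu -E Ew.
  by rewrite Eh compmA Ev.
have e1 := lift2 _ _ _ _ Euf Eu1 Evf Ef.
have e2 := lift2 _ _ _ _ Eug Eu2 Evg Eg.
exists (@Frac M N (QIndex CD CK) (vf \oc fr_map f \oc u1)); split.
  by exists u1, vf.
by exists u2, vg; split=> //=; apply: ee; rewrite e1 e2.
Qed.

Lemma graph_map M N (f : frac M N) X (x : hom X (qi_src f)) (y : hom X N) :
  fr_map f \oc x = qi_pr f \oc y -> graph f (qi_in f \oc x) y.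
Proof. by move=> e; exists x. Qed.

Lemma germ_common M N M' N' (f : frac M N) (g : frac M' N') X (s : hom X M)
    (y : hom X N) (s' : hom X M') (y' : hom X N') : germ f s y -> germ g s' y' ->
  exists Y (t : hom Y X),
    [/\ cepi t, graph f (s \oc t) (y \oc t) & graph g (s' \oc t) (y' \oc t)].
Proof.
move=> gf [Y [t [ct gg]]]; have [Z [t' [ct' gf']]] := germ_comp t gf.
exists Z, (t \oc t'); split; first exact: cepi_comp.
  by rewrite !compmA.
by rewrite !compmA; apply: graph_comp.
Qed.

Lemma germ_add M N (i : qindex M N) (a b : hom (qi_src i) (qi_tgt i)) X
    (s : hom X M) (y z : hom X N) :
  germ (Frac a) s y -> germ (Frac b) s z -> germ (Frac (a + b)) s (y + z).
Proof.
move=> ga gb; have [Y [t [ct [u [Eu Ea]] [u' [Eu' Eb]]]]] := germ_common ga gb.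
have uu : u' = u by apply: (@qi_in_mono _ _ i); rewrite Eu' Eu.
exists Y, t; split=> //; exists u; split=> //=.
by rewrite {}uu /= in Eb; rewrite compmDl [in RHS]compmDl compmDr -Ea -Eb.
Qed.

Lemma germ_scale M N (i : qindex M N) c (a : hom (qi_src i) (qi_tgt i)) X
    (s : hom X M) (y : hom X N) :
  germ (Frac a) s y -> germ (Frac (c *: a)) s (c *: y).
Proof.
move=> [Y [t [ct [u [Eu Ea]]]]]; exists Y, t; split=> //; exists u; split=> //=.
by rewrite compmZl [in RHS]compmZl compmZr -Ea.
Qed.

Lemma germ_lin M N (f : frac M N) a X (s s' : hom X M) (y y' : hom X N) :
  germ f s y -> germ f s' y' -> germ f (a *: s + s') (a *: y + y').
Proof.
move=> gy gy'; have [Y [t [ct [u [Eu E]] [u' [Eu' E']]]]] := germ_common gy gy'.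
exists Y, t; split=> //; exists (a *: u + u').
by rewrite !compmPl !compmPr Eu Eu' E E'.
Qed.

Lemma germ_mor M N (i : qindex M N) (f : hom M N) X (s : hom X M) :
  germ (Frac (qi_pr i \oc f \oc qi_in i)) s (f \oc s).
Proof.
have [Y [t [b [ct Eb]]]] := ore s (@qi_in_cepi _ _ i).
by exists Y, t; split=> //; exists b; split=> //=; rewrite -!compmA Eb.
Qed.

Lemma germ_composite M N P (g : frac N P) (f : frac M N) (h : frac M P) X
    (s : hom X M) (y : hom X N) (z : hom X P) :
  is_composite g f h -> germ f s y -> germ g y z -> germ h s z.
Proof.
move=> [X0 [x0 [y0 [z0 [ex0 gf0 gg0 /graph_map gh0]]]]] gf gg.
have cs0 : cepi (qi_in h \oc x0).
  by apply: cepi_comp; [apply: qi_in_cepi|apply: epi_cepi].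
have [Y [t [r [ct Et]]]] := ore s cs0.
have := germ_comp t gf; rewrite Et => gft.
have [Y2 [t2 [ct2 E2]]] := germ_fun gft (graph_germ (graph_comp r gf0)).
have := germ_comp (t \oc t2) gg; rewrite compmA E2 -compmA => ggt.
have [Y3 [t3 [ct3 E3]]] := germ_fun ggt (graph_germ (graph_comp (r \oc t2) gg0)).
apply: (germ_local ct); apply: (germ_local ct2); apply: (germ_local ct3).
rewrite Et -!compmA in E3 *; rewrite E3 !compmA.
by do 3!apply: germ_comp; apply: graph_germ.
Qed.

Lemma composite_ex M N P (g : frac N P) (f : frac M N) :
  exists h, is_composite g f h.
Proof.
have [X1 [t1 [y1 [ct1 gf1]]]] := graph_total f (idm M).
have [X [t2 [z [ct2 gg]]]] := graph_total g y1.
have := graph_comp t2 gf1; rewrite comp1m in gf1 *.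
have : cepi (t1 \oc t2) by apply: cepi_comp => //; rewrite comp1m in ct1.
move: (t1 \oc t2) (y1 \oc t2) gg => s y gg cs gf {t1 t2 y1 X1 ct1 ct2 gf1}.
have [L [l kl]] := ab_kernel hA (qi_pr f \oc qi_in g).
have CL : C L.
  apply: (cmono_comp (@qi_pr_cmono _ _ f) (mono_cmono (@qi_in_mono _ _ g))).
    exact: (ker_mono kl).
  exact: kl.1.
have [W [c cc]] := ab_cokernel hA (fr_map g \oc l).
have [|K [a [b [_ Eb kK]]]] := quotient_sub (q := c \oc qi_pr g).
  by apply: epi_comp; [apply: coker_epi cc|apply: qi_pr_epi].
have CK : C (so_obj K).
  apply: (cmono_comp (cokerC_cmono CL cc) (@qi_pr_cmono _ _ g)).
    exact: (ker_mono kK).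
  exact: kK.1.
have [|h [x [ex Ex Eh]]] := frac_make (s := s) (y := z) (K := K) cs CK; last first.
  by exists h, X, x, y, z; rewrite Ex.
move=> Y t st; have [u [Eu Ef]] := gf; have [v [Ev Eg]] := gg.
have ut : u \oc t = 0.
  by apply: (mono0 (@qi_in_mono _ _ f)); rewrite compmA Eu.
have [|t' Et'] := ker_fact (g := v \oc t) kl.
  by rewrite -compmA [qi_in g \oc _]compmA Ev compmA -Ef -compmA ut compm0.
rewrite -Eb -!compmA [qi_pr g \oc _]compmA -Eg -compmA Et'.
by rewrite [fr_map g \oc _]compmA [c \oc _]compmA cc.1 comp0m compm0.
Qed.

Lemma index_ex M N : inhabited (qindex M N).
Proof.
have [Z zZ] := ab_zero hA; have CZ := serre_zero hC zZ.
have [D [m [mm _ _]]] := kernel_sub (0 : hom M Z).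
have [K [e [ee _ _]]] := image_sub (0 : hom Z N).
split; apply: (@QIndex _ _ D K); first exact: (serre_sub hC mm CZ).
exact: (serre_quo hC ee CZ).
Qed.

Lemma common_index M N (f g : frac M N) :
  exists (i : qindex M N) (a b : hom (qi_src i) (qi_tgt i)),
    frac_eqv f (Frac a) /\ frac_eqv g (Frac b).
Proof.
have [D [CD [uf Euf] [ug Eug]]] := sub_meet (qi_subC f) (qi_subC g).
have [K [CK [vf Evf] [vg Evg]]] := sub_join (qi_kerC f) (qi_kerC g).
exists (QIndex CD CK), (vf \oc fr_map f \oc uf), (vg \oc fr_map g \oc ug).
split; eexists; (split; last exact: frac_le_refl); by [exists uf, vf|exists ug, vg].
Qed.

Lemma frac_eqv_refl M N (f : frac M N) : frac_eqv f f.
Proof. by exists f; split; apply: frac_le_refl. Qed.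

Lemma frac_eqv_sym M N (f g : frac M N) : frac_eqv f g -> frac_eqv g f.
Proof. by move=> [h []]; exists h. Qed.

Lemma frac_eqv_trans M N (f g h : frac M N) :
  frac_eqv f g -> frac_eqv g h -> frac_eqv f h.
Proof.
move=> fg gh; have [Y [t [y [ct gf]]]] := graph_total f (idm M).
have {}gf := graph_germ gf.
have gg := germ_eqv fg gf; have gh' := germ_eqv gh gg.
by apply: (germ_eqv_conv _ gf gh'); rewrite comp1m.
Qed.

HB.instance Definition _ M N := gen_eqMixin (frac M N).
HB.instance Definition _ M N := gen_choiceMixin (frac M N).

Definition frac_rel M N : rel (frac M N) := fun f g => `[< frac_eqv f g >].

Lemma frac_rel_refl M N : reflexive (@frac_rel M N).
Proof. by move=> f; apply/asboolP/frac_eqv_refl. Qed.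

Lemma frac_rel_sym M N : symmetric (@frac_rel M N).
Proof. by move=> f g; apply/asboolP/asboolP => /frac_eqv_sym. Qed.

Lemma frac_rel_trans M N : transitive (@frac_rel M N).
Proof.
by move=> f g h /asboolP e /asboolP e'; apply/asboolP/(frac_eqv_trans e e').
Qed.

Canonical frac_equiv M N :=
  EquivRel (@frac_rel M N) (@frac_rel_refl M N) (@frac_rel_sym M N)
    (@frac_rel_trans M N).

(* colim_{M', N'} Hom_A(M', N / N') *)
Definition qhom M N := {eq_quot (frac_equiv M N)}%qT.
HB.instance Definition _ M N := Choice.on (qhom M N).

Definition qclass M N (f : frac M N) : qhom M N := (\pi_(qhom M N) f)%qT.

Lemma qclassP M N (f g : frac M N) : qclass f = qclass g <-> frac_eqv f g.
Proof.
split=> [/eqmodP/asboolP //|e].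
by apply/eqmodP/asboolP.
Qed.

Lemma qclass_ex M N (p : qhom M N) : exists f, p = qclass f.
Proof. by exists (repr p); rewrite /qclass reprK. Qed.

Lemma qadd_ex M N (p q : qhom M N) : exists r : qhom M N,
  exists (i : qindex M N) (a b : hom (qi_src i) (qi_tgt i)),
    [/\ p = qclass (Frac a), q = qclass (Frac b) & r = qclass (Frac (a + b))].
Proof.
have [f ->] := qclass_ex p; have [g ->] := qclass_ex q.
have [i [a [b [/qclassP -> /qclassP ->]]]] := common_index f g.
by exists (qclass (Frac (a + b))), i, a, b.
Qed.

Lemma qscale_ex M N (c : k) (p : qhom M N) : exists r : qhom M N,
  exists (i : qindex M N) (a : hom (qi_src i) (qi_tgt i)),
    p = qclass (Frac a) /\ r = qclass (Frac (c *: a)).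
Proof.
have [[i a] ->] := qclass_ex p.
by exists (qclass (Frac (c *: a))), i, a.
Qed.

Lemma qmor_ex M N (f : hom M N) : exists r : qhom M N,
  exists i : qindex M N, r = qclass (Frac (qi_pr i \oc f \oc qi_in i)).
Proof. by have [i] := index_ex M N; eexists; exists i. Qed.

Lemma qcomp_ex M N P (q : qhom N P) (p : qhom M N) : exists r : qhom M P,
  exists f g h,
    [/\ p = qclass f, q = qclass g, r = qclass h & is_composite g f h].
Proof.
have [f ->] := qclass_ex p; have [g ->] := qclass_ex q.
by have [h gfh] := composite_ex g f; exists (qclass h), f, g, h.
Qed.

(* By the lemmas qgerm_* below, the following operations do not depend on the
   choices made by cid. *)
Definition qadd M N (p q : qhom M N) : qhom M N :=
  sval (cid (qadd_ex p q)).

Definition qscale M N (c : k) (p : qhom M N) : qhom M N :=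
  sval (cid (qscale_ex c p)).

(* The image of f under the canonical functor A -> A / C. *)
Definition qmor M N (f : hom M N) : qhom M N := sval (cid (qmor_ex f)).

Definition qcomp M N P (q : qhom N P) (p : qhom M N) : qhom M P :=
  sval (cid (qcomp_ex q p)).

Definition qgerm M N (p : qhom M N) X (s : hom X M) (y : hom X N) :=
  exists f, p = qclass f /\ germ f s y.

Lemma qgermE M N (f : frac M N) X (s : hom X M) (y : hom X N) :
  qgerm (qclass f) s y <-> germ f s y.
Proof.
split=> [[g [/qclassP e]]|]; last by exists f.
by apply: germ_eqv; apply: frac_eqv_sym.
Qed.

Lemma qgerm_comp M N (p : qhom M N) X Y (s : hom X M) (y : hom X N) (t : hom Y X) :
  qgerm p s y -> qgerm p (s \oc t) (y \oc t).
Proof. by move=> [f [-> g]]; apply/qgermE/germ_comp. Qed.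

Lemma qgerm_total M N (p : qhom M N) X (s : hom X M) :
  exists Y (t : hom Y X) (y : hom Y N), cepi t /\ qgerm p (s \oc t) y.
Proof.
have [f ->] := qclass_ex p; have [Y [t [y [ct g]]]] := graph_total f s.
by exists Y, t, y; split=> //; apply/qgermE/graph_germ.
Qed.

Lemma qgerm_inj M N (p q : qhom M N) X (s : hom X M) (y : hom X N) :
  cepi s -> qgerm p s y -> qgerm q s y -> p = q.
Proof.
by move=> cs [f [-> gf]] [g [-> gg]]; apply/qclassP/(germ_eqv_conv cs gf gg).
Qed.

Lemma qgerm_add M N (p q : qhom M N) X (s : hom X M) (y z : hom X N) :
  qgerm p s y -> qgerm q s z -> qgerm (qadd p q) s (y + z).
Proof.
rewrite /qadd; case: cid => r [i [a [b [Ep Eq Er]]]] /=; rewrite {}Ep {}Eq {}Er => /qgermE ga /qgermE gb.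
exact/qgermE/germ_add.
Qed.

Lemma qgerm_scale M N c (p : qhom M N) X (s : hom X M) (y : hom X N) :
  qgerm p s y -> qgerm (qscale c p) s (c *: y).
Proof.
rewrite /qscale; case: cid => r [i [a [Ep Er]]] /=; rewrite {}Ep {}Er => /qgermE ga.
exact/qgermE/germ_scale.
Qed.

Lemma qgerm_mor M N (f : hom M N) X (s : hom X M) : qgerm (qmor f) s (f \oc s).
Proof. rewrite /qmor; case: cid => r [i Er] /=; rewrite {}Er; exact/qgermE/germ_mor. Qed.

Lemma qgerm_qcomp M N P (q : qhom N P) (p : qhom M N) X
    (s : hom X M) (y : hom X N) (z : hom X P) :
  qgerm p s y -> qgerm q y z -> qgerm (qcomp q p) s z.
Proof.
rewrite /qcomp; case: cid => r [f [g [h [Ep Eq Er gfh]]]] /=; rewrite {}Ep {}Eq {}Er => /qgermE gf /qgermE gg.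
exact/qgermE/(germ_composite gfh gf gg).
Qed.

Lemma qgerm_lin M N (p : qhom M N) a X (s s' : hom X M) (y y' : hom X N) :
  qgerm p s y -> qgerm p s' y' -> qgerm p (a *: s + s') (a *: y + y').
Proof.
by have [f ->] := qclass_ex p; move=> /qgermE g /qgermE g'; apply/qgermE/germ_lin.
Qed.

Lemma qgerm_ex M N (p : qhom M N) :
  exists Y (t : hom Y M) (y : hom Y N), cepi t /\ qgerm p t y.
Proof.
by have [Y [t [y]]] := qgerm_total p (idm M); rewrite comp1m; exists Y, t, y.
Qed.

Lemma qgerm_ex2 M N (p q : qhom M N) : exists Y (t : hom Y M) (y z : hom Y N),
  [/\ cepi t, qgerm p t y & qgerm q t z].
Proof.
have [X [t [y [ct gp]]]] := qgerm_ex p.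
have [Y [t' [z [ct' gq]]]] := qgerm_total q t.
exists Y, (t \oc t'), (y \oc t'), z; split=> //; first exact: cepi_comp.
exact: qgerm_comp.
Qed.

Lemma qgerm_ex_comp M N P (p : qhom M N) (q : qhom N P) :
  exists Y (t : hom Y M) (y : hom Y N) (z : hom Y P),
  [/\ cepi t, qgerm p t y & qgerm q y z].
Proof.
have [X [t [y [ct gp]]]] := qgerm_ex p.
have [Y [t' [z [ct' gq]]]] := qgerm_total q y.
exists Y, (t \oc t'), (y \oc t'), z; split=> //; first exact: cepi_comp.
exact: qgerm_comp.
Qed.

Lemma qaddC M N : commutative (@qadd M N).
Proof.
move=> p q; have [Y [t [y [z [ct gp gq]]]]] := qgerm_ex2 p q.
apply: (qgerm_inj ct (qgerm_add gp gq)).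
by rewrite addrC; apply: qgerm_add.
Qed.

Lemma qaddA M N : associative (@qadd M N).
Proof.
move=> p q r; have [X [s [y [z [cs gp gq]]]]] := qgerm_ex2 p q.
have [Y [t [w [ct gr]]]] := qgerm_total r s.
have {}gp := qgerm_comp t gp; have {}gq := qgerm_comp t gq.
apply: (qgerm_inj (cepi_comp cs ct) (qgerm_add gp (qgerm_add gq gr))).
by rewrite addrA; do 2!apply: qgerm_add => //.
Qed.

Lemma qadd0 M N : left_id (qmor 0) (@qadd M N).
Proof.
move=> p; have [Y [t [y [ct gp]]]] := qgerm_ex p.
have g0 := qgerm_mor (0 : hom M N) t.
by apply: (qgerm_inj ct (qgerm_add g0 gp)); rewrite comp0m add0r.
Qed.

Lemma qaddN M N : left_inverse (qmor 0) (@qscale M N (-1)) (@qadd M N).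
Proof.
move=> p; have [Y [t [y [ct gp]]]] := qgerm_ex p.
apply: (qgerm_inj ct (qgerm_add (qgerm_scale (-1) gp) gp)).
by rewrite scaleN1r addNr -(comp0m _ t); apply: qgerm_mor.
Qed.

HB.instance Definition _ M N := GRing.isZmodule.Build (qhom M N)
  (@qaddA M N) (@qaddC M N) (@qadd0 M N) (@qaddN M N).

Lemma qgermD M N (p q : qhom M N) X (s : hom X M) (y z : hom X N) :
  qgerm p s y -> qgerm q s z -> qgerm (p + q) s (y + z).
Proof. exact: qgerm_add. Qed.

Lemma qscaleA M N c d (p : qhom M N) : qscale c (qscale d p) = qscale (c * d) p.
Proof.
have [Y [t [y [ct gp]]]] := qgerm_ex p.
apply: (qgerm_inj ct (qgerm_scale c (qgerm_scale d gp))).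
by rewrite scalerA; apply: qgerm_scale.
Qed.

Lemma qscale1 M N : left_id 1 (@qscale M N).
Proof.
move=> p; have [Y [t [y [ct gp]]]] := qgerm_ex p.
by apply: (qgerm_inj ct (qgerm_scale 1 gp)); rewrite scale1r.
Qed.

Lemma qscaleDr M N : right_distributive (@qscale M N) +%R.
Proof.
move=> c p q; have [Y [t [y [z [ct gp gq]]]]] := qgerm_ex2 p q.
apply: (qgerm_inj ct (qgerm_scale c (qgermD gp gq))).
by rewrite scalerDr; apply: qgermD; apply: qgerm_scale.
Qed.

Lemma qscaleDl M N (p : qhom M N) : {morph (@qscale M N)^~ p : c d / c + d}.
Proof.
move=> c d; have [Y [t [y [ct gp]]]] := qgerm_ex p.
apply: (qgerm_inj ct (qgerm_scale (c + d) gp)).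
by rewrite scalerDl; apply: qgermD; apply: qgerm_scale.
Qed.

HB.instance Definition _ M N := GRing.Zmodule_isLmodule.Build k (qhom M N)
  (@qscaleA M N) (@qscale1 M N) (@qscaleDr M N) (@qscaleDl M N).

Lemma qgermP M N a (p q : qhom M N) X (s : hom X M) (y z : hom X N) :
  qgerm p s y -> qgerm q s z -> qgerm (a *: p + q) s (a *: y + z).
Proof. by move=> gp; apply: qgermD; apply: qgerm_scale. Qed.

Lemma qcomp1m M N (p : qhom M N) : qcomp (qmor (idm N)) p = p.
Proof.
have [Y [t [y [ct gp]]]] := qgerm_ex p.
apply: (qgerm_inj ct _ gp); apply: (qgerm_qcomp gp).
by rewrite -{2}[y]comp1m; apply: qgerm_mor.
Qed.

Lemma qcompm1 M N (p : qhom M N) : qcomp p (qmor (idm M)) = p.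
Proof.
have [Y [t [y [ct gp]]]] := qgerm_ex p.
apply: (qgerm_inj ct _ gp); apply: (qgerm_qcomp _ gp).
by rewrite -{2}[t]comp1m; apply: qgerm_mor.
Qed.

Lemma qcompA M N P Q (r : qhom P Q) (q : qhom N P) (p : qhom M N) :
  qcomp r (qcomp q p) = qcomp (qcomp r q) p.
Proof.
have [X [s [y [z [cs gp gq]]]]] := qgerm_ex_comp p q.
have [Y [t [w [ct gr]]]] := qgerm_total r z.
have {}gp := qgerm_comp t gp; have {}gq := qgerm_comp t gq.
apply: (qgerm_inj (cepi_comp cs ct) (qgerm_qcomp (qgerm_qcomp gp gq) gr)).
exact: (qgerm_qcomp gp (qgerm_qcomp gq gr)).
Qed.

Lemma qcompPl M N P a (q q' : qhom N P) (p : qhom M N) :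
  qcomp (a *: q + q') p = a *: qcomp q p + qcomp q' p.
Proof.
have [X [s [y [z [cs gp gq]]]]] := qgerm_ex_comp p q.
have [Y [t [w [ct gr]]]] := qgerm_total q' y.
have {}gp := qgerm_comp t gp; have {}gq := qgerm_comp t gq.
apply: (qgerm_inj (cepi_comp cs ct) (qgerm_qcomp gp (qgermP a gq gr))).
by apply: qgermP; apply: (qgerm_qcomp gp).
Qed.

Lemma qcompPr M N P a (q : qhom N P) (p p' : qhom M N) :
  qcomp q (a *: p + p') = a *: qcomp q p + qcomp q p'.
Proof.
have [X [s [y [y' [cs gp gp']]]]] := qgerm_ex2 p p'.
have [Y [t [z [ct gq]]]] := qgerm_total q y.
have [Z [r [z' [cr gq']]]] := qgerm_total q (y' \oc t).
have {}gp := qgerm_comp (t \oc r) gp; have {}gp' := qgerm_comp (t \oc r) gp'.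
have {}gq := qgerm_comp r gq.
rewrite -compmA in gq; rewrite -compmA in gq'.
have cstr := cepi_comp cs (cepi_comp ct cr).
have gl := qgermP a (qgerm_qcomp gp gq) (qgerm_qcomp gp' gq').
apply: (qgerm_inj cstr _ gl); apply: (qgerm_qcomp (qgermP a gp gp')).
exact: qgerm_lin.
Qed.

Lemma qmorP M N a (f g : hom M N) : qmor (a *: f + g) = a *: qmor f + qmor g.
Proof.
have ci := epi_cepi (@idm_epi _ _ M).
apply: (qgerm_inj ci (qgerm_mor _ _)).
by rewrite compmPl; apply: qgermP; apply: qgerm_mor.
Qed.

Lemma qmor_comp M N P (g : hom N P) (f : hom M N) :
  qmor (g \oc f) = qcomp (qmor g) (qmor f).
Proof.
have ci := epi_cepi (@idm_epi _ _ M).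
apply: (qgerm_inj ci (qgerm_mor _ _)); rewrite -compmA.
by apply: qgerm_qcomp; apply: qgerm_mor.
Qed.

Lemma qclass_mor M N (f : frac M N) :
  qcomp (qmor (qi_pr f)) (qcomp (qclass f) (qmor (qi_in f))) = qmor (fr_map f).
Proof.
have [Y [t [y [ct [u [Eu E]]]]]] := graph_total f (qi_in f).
have {Eu}Eu : u = t by apply: (@qi_in_mono _ _ f).
rewrite {}Eu in E.
apply: (qgerm_inj ct _ (qgerm_mor (fr_map f) t)); rewrite E.
apply: qgerm_qcomp (qgerm_mor _ y); apply: qgerm_qcomp (qgerm_mor _ t) _.
by apply/qgermE/graph_germ; exists t.
Qed.

Definition serre_quotient : klinear_category k :=
  @KLinearCategory k A (fun M N => qhom M N : lmodType k) (fun M => qmor (idm M))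
    qcomp qcomp1m qcompm1 qcompA qcompPl qcompPr.

End SerreQuotient.

Arguments serre_quotient {k A} [C] hA hC.

(* Main.v *)
From HB Require Import structures.
From mathcomp Require Import all_boot all_algebra.
From mathcomp Require Import boolp.
Require Import Defs.

(** Write Q for A / C and T : A -> Q for the canonical functor (quo below).

    Everything about Q is reduced to A by a calculus of fractions. Call s a
    C-epimorphism if its cokernel is in C, and a C-monomorphism if its kernel
    is (cepi and cmono). Then T s is epi exactly when s is a C-epimorphism, mono
    exactly when s is a C-monomorphism, and invertible when s is both. Every
    morphism p of Q satisfies p o T t = T y for some C-epimorphism t
    (quo_presentation); T f = 0 exactly when f vanishes along some
    C-epimorphism (quo_eq0_local); and T y factors through T s, for s a
    C-epimorphism, as soon as T y kills whatever s kills (quo_descent). With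
    these three facts kernels and cokernels in A are seen to remain so in Q
    (quo_kernel, quo_cokernel).

    Q is abelian because every morphism of Q is T f up to isomorphisms of its
    source and target (quo_arrow): the kernel and cokernel of T f come from those
    of f, and if T f is mono (epi), then in the factorization of f through its
    image the epi (mono) part becomes invertible, so that T f is a kernel (a
    cokernel) because its other part is one in A.

    The finiteness conditions follow by dévissage along a composition series,
    since T is exact. If S is simple in A, then T S is zero or simple: a nonzero
    p : Y -> T S is presented by some y : X -> S that is nonzero, hence epi,
    which makes p epi (quo_simple). So T preserves finite length. For the Hom
    spaces, Hom_Q(-, N) and Hom_Q(M, -) are left exact, which bounds Hom_Q(M, N)
    by the spaces Hom_Q(S, S') with S and S' composition factors of M and N; and
    T is full between simple objects (quo_full_simple), so these are quotients of
    Hom_A(S, S'). *)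

Set Implicit Arguments.
Unset Strict Implicit.
Unset Printing Implicit Defensive.

Import GRing.Theory.
Local Open Scope ring_scope.
Local Open Scope cat_scope.

(** * Finite-dimensional vector spaces *)

Section FiniteDimension.
Context {k : fieldType}.

Definition as_linear (U V : lmodType k) (u : U -> V) (u_lin : linear u) :
    {linear U -> V} :=
  HB.pack u (GRing.isLinear.Build k U V *:%R u u_lin).

(** The vectors e i need not satisfy P, so that the condition passes to smaller
    predicates without any argument on subspaces. *)
Definition finitely_spanned (V : lmodType k) (P : V -> Prop) :=
  exists n (e : 'I_n -> V), forall x, P x ->
    exists c : 'I_n -> k, x = \sum_i c i *: e i.

Lemma finite_dimensional_spanned (V : lmodType k) :
  finite_dimensional V -> finitely_spanned (fun _ : V => True).
Proof.
move=> [n [phi [psi phiK psiK]]]; exists n, (fun i => psi 'e_i) => x _.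
exists (fun i => phi x 0 i); apply: (can_inj phiK).
rewrite linear_sum {1}[phi x]row_sum_delta; apply: eq_bigr => i _.
by rewrite linearZ psiK.
Qed.

(** A spanning family of minimal size is free, because a vector occurring in a
    relation could be dropped; its coordinates are then unique, hence linear. *)
Lemma spanned_finite_dimensional (V : lmodType k) :
  finitely_spanned (fun _ : V => True) -> finite_dimensional V.
Proof.
move=> sV.
have exn : exists n, `[< exists e : 'I_n -> V, forall x, exists c : 'I_n -> k,
    x = \sum_i c i *: e i >].
  by have [n [e eP]] := sV; exists n; apply/asboolP; exists e => x; apply: eP.
case: (ex_minnP exn) => n /asboolP[e /choice[c cE]] n_min.
have e_free (d : 'I_n -> k) : \sum_i d i *: e i = 0 -> forall j, d j = 0.
  move=> d0 j; apply/eqP/negPn/negP => dj; suff: (n <= n.-1)%N.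
    by case: (n) j {c cE n_min d d0 dj e} => [[]//|m _]; rewrite ltnn.
  apply: n_min; apply/asboolP; exists (fun i => e (lift j i)) => x.
  (* Use the relation d to eliminate e j from the expression of x. *)
  exists (fun i => c x (lift j i) - c x j / d j * d (lift j i)).
  move: d0; rewrite (bigD1_ord j) //= => /addr0_eq d0.
  rewrite {1}[x]cE (bigD1_ord j) //=.
  have -> : e j = - (d j)^-1 *: \sum_(i < n.-1) d (lift j i) *: e (lift j i).
    by rewrite -d0 scalerN scaleNr opprK scalerA mulVf // scale1r.
  rewrite scalerA scaler_sumr -big_split /=; apply: eq_bigr => i _.
  by rewrite scalerA -scalerDl addrC mulrN mulNr.
have cU x d : x = \sum_i d i *: e i -> c x = d.
  move=> xd; apply/funext => i; apply/eqP; rewrite -subr_eq0; apply/eqP.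
  apply: (e_free (fun i => c x i - d i)).
  under eq_bigr do rewrite scalerBl.
  by rewrite sumrB -cE -xd subrr.
pose phi x : 'rV[k]_n := \row_i c x i.
have phi_lin : linear phi.
  move=> a x y; apply/rowP => i; rewrite !mxE.
  rewrite (cU _ (fun i => a * c x i + c y i)) //.
  rewrite {1}[x]cE {1}[y]cE scaler_sumr -big_split /=; apply: eq_bigr => j _.
  by rewrite scalerDl scalerA.
exists n, (as_linear phi_lin).
exists (fun v : 'rV_n => \sum_i v 0 i *: e i) => [x|v] /=.
  by rewrite [RHS]cE; apply: eq_bigr => i _; rewrite mxE.
by apply/rowP => i; rewrite mxE (cU _ (fun i => v 0 i)).
Qed.

Lemma finite_dimensional_surj (U V : lmodType k) (u : U -> V) : linear u ->
  finite_dimensional U -> (forall x, exists y, x = u y) -> finite_dimensional V.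
Proof.
move=> u_lin /finite_dimensional_spanned[n [e eP]] u_surj.
pose uL := as_linear u_lin.
apply: spanned_finite_dimensional; exists n, (u \o e) => x _.
have [y ->] := u_surj x; have [c cE] := eP y I; exists c.
by rewrite {1}cE -[LHS]/(uL _) linear_sum; apply: eq_bigr => i _; rewrite linearZ.
Qed.

(** Dimension is subadditive along an exact U -> V -> W. Identify W with k^n and
    filter V by the subspaces K j on which the first j coordinates of v vanish:
    K n = ker v is spanned by the image of U, K 0 = V, and passing from K j.+1 to
    K j requires at most one more vector. *)
Lemma finite_dimensional_exact (U V W : lmodType k) (u : U -> V) (v : V -> W) :
  linear u -> linear v -> finite_dimensional U -> finite_dimensional W ->
  (forall x, v x = 0 -> exists y, x = u y) -> finite_dimensional V.
Proof.
move=> u_lin v_lin fdU [n [phi [psi phiK psiK]]] uv.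
pose uL := as_linear u_lin.
pose f : {linear V -> 'rV[k]_n} := (phi \o as_linear v_lin)%FUN.
pose K j (x : V) := forall i : 'I_n, (i < j)%N -> f x 0 i = 0.
suff sK j : (j <= n)%N -> finitely_spanned (K (n - j)%N).
  apply: spanned_finite_dimensional; have [m [e eP]] := sK n (leqnn n).
  by exists m, e => x _; apply: eP => i; rewrite subnn.
elim: j => [_|j IHj jn].
  have [m [e eP]] := finite_dimensional_spanned fdU; exists m, (u \o e) => x.
  rewrite subn0 => Kx; have [|y ->] := uv x.
    apply: (can_inj phiK); rewrite linear0; apply/rowP => i.
    by rewrite [LHS]Kx // mxE.
  have [c cE] := eP y I; exists c.
  by rewrite {1}cE -[LHS]/(uL _) linear_sum; apply: eq_bigr => i _; rewrite linearZ.
have [m [e eP]] := IHj (ltnW jn).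
have ltn : (n - j.+1 < n)%N by rewrite ltn_subrL (leq_trans _ jn).
pose i0 := Ordinal ltn.
have Ksplit x : K (n - j.+1)%N x -> f x 0 i0 = 0 -> K (n - j)%N x.
  move=> Kx x0 i; rewrite -[(n - j)%N]prednK ?subn_gt0 // -subnS ltnS leq_eqVlt.
  case/orP=> [/eqP ii0|/Kx //].
  by rewrite -[RHS]x0; congr (f x 0 _); apply: val_inj.
(* Any z in the larger step with nonzero new coordinate completes the span. *)
have [[z [Kz z0]]|noz] := pselect (exists z, K (n - j.+1)%N z /\ f z 0 i0 <> 0).
  exists m.+1, (fun i => if unlift ord0 i is Some i' then e i' else z) => x Kx.
  pose a := f x 0 i0 / f z 0 i0.
  have [|c cE] := eP (x - a *: z).
    apply: Ksplit => [i ij|].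
      by rewrite linearB linearZ !mxE Kx // Kz // mulr0 subr0.
    by rewrite linearB linearZ !mxE /a mulfVK ?subrr //; apply/eqP.
  exists (fun i => if unlift ord0 i is Some i' then c i' else a).
  rewrite big_ord_recl unlift_none.
  under eq_bigr do rewrite liftK.
  by rewrite -cE addrC subrK.
exists m, e => x Kx; apply: eP; apply: Ksplit => //.
by apply/eqP/negPn/negP => /eqP x0; apply: noz; exists x.
Qed.

Lemma finite_dimensional_eq0 (V : lmodType k) :
  (forall x : V, x = 0) -> finite_dimensional V.
Proof.
move=> V0; apply: spanned_finite_dimensional.
by exists 0%N, (fun=> 0) => x _; exists (fun=> 0); rewrite big_ord0.
Qed.

End FiniteDimension.

(** * Isomorphisms, kernels and simple objects *)

Section Categories.
Context {k : fieldType} {A : klinear_category k}.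
Implicit Types X Y Z W S : A.

Lemma compm_linear X Y Z (g : hom Y Z) :
  linear (fun f : hom X Y => g \oc f).
Proof. by move=> a f f'; rewrite compmPr. Qed.

Lemma precompm_linear X Y Z (f : hom X Y) :
  linear (fun g : hom Y Z => g \oc f).
Proof. by move=> a g g'; rewrite compmPl. Qed.

Lemma idm_mono X : mono (idm X).
Proof. by move=> W g h; rewrite !comp1m. Qed.

Lemma iso_mono X Y (f : hom X Y) : iso f -> mono f.
Proof.
by move=> [g [gf _]]; apply: (@mono_compl _ _ _ _ _ g); rewrite gf; apply: idm_mono.
Qed.

Lemma iso_epi X Y (f : hom X Y) : iso f -> epi f.
Proof.
by move=> [g [_ fg]]; apply: (@epi_compr _ _ _ _ _ _ g); rewrite fg; apply: idm_epi.
Qed.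

(** The next four lemmas compare f with b f a, which is isomorphic to f as an
    arrow when a and b are isomorphisms: kernels and cokernels transfer from one
    to the other, and so does the property of being a kernel or a cokernel. *)
Lemma is_kernel_iso X Y X' Y' K (a : hom X' X) (b : hom Y Y') (f : hom X Y)
    (i : hom K X') :
  iso a -> mono b -> is_kernel (b \oc (f \oc a)) i -> is_kernel f (a \oc i).
Proof.
move=> ia mb ki; have [a' [_ aa']] := ia; apply: kerI.
- by apply: mono_comp; [apply: iso_mono|apply: ker_mono ki].
- by apply: (mono0 mb); rewrite [f \oc _]compmA compmA ki.1.
- move=> W g fg; have [|h Eh] := ker_fact (g := a' \oc g) ki.
    by rewrite -!compmA [a \oc _]compmA aa' comp1m fg compm0.
  by exists h; rewrite -compmA -Eh compmA aa' comp1m.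
Qed.

Lemma is_cokernel_iso X Y X' Y' Q (a : hom X' X) (b : hom Y Y') (f : hom X Y)
    (p : hom Y' Q) :
  epi a -> iso b -> is_cokernel (b \oc (f \oc a)) p -> is_cokernel f (p \oc b).
Proof.
move=> ea ib cp; have [b' [b'b _]] := ib; apply: cokerI.
- by apply: epi_comp; [apply: coker_epi cp|apply: iso_epi].
- by apply: (epi0 ea); rewrite -!compmA cp.1.
- move=> W g gf; have [|h Eh] := coker_fact (g := g \oc b') cp.
    by rewrite compmA -[g \oc b' \oc b]compmA b'b compm1 compmA gf comp0m.
  by exists h; rewrite compmA -Eh -compmA b'b compm1.
Qed.

Lemma kernel_arrow_iso X Y X' Y' Z (a : hom X' X) (b : hom Y Y') (f : hom X Y)
    (g : hom Y' Z) :
  iso a -> mono b -> is_kernel g (b \oc (f \oc a)) -> is_kernel (g \oc b) f.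
Proof.
move=> [a' [a'a aa']] mb kf.
have fE : f = f \oc a \oc a' by rewrite -compmA aa' compm1.
apply: kerI.
- rewrite fE; apply: mono_comp; last by apply: iso_mono; exists a.
  exact: mono_compl (ker_mono kf).
- by rewrite fE compmA -[g \oc b \oc _]compmA kf.1 comp0m.
- move=> W u; rewrite -compmA => gu; have [h Eh] := ker_fact kf gu.
  by exists (a \oc h); apply: mb; rewrite Eh -!compmA.
Qed.

Lemma cokernel_arrow_iso X Y X' Y' Z (a : hom X' X) (b : hom Y Y') (f : hom X Y)
    (g : hom Z X') :
  epi a -> iso b -> is_cokernel g (b \oc (f \oc a)) -> is_cokernel (a \oc g) f.
Proof.
move=> ea [b' [b'b bb']] kf.
have fE : f = b' \oc (b \oc f) by rewrite compmA b'b comp1m.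
apply: cokerI.
- rewrite fE; apply: epi_comp; first by apply: iso_epi; exists b.
  apply: (@epi_compr _ _ _ _ _ _ a); rewrite -compmA.
  exact: coker_epi kf.
- rewrite fE -compmA.
  have -> : b \oc f \oc (a \oc g) = 0 by rewrite -kf.1 !compmA.
  by rewrite compm0.
- move=> W u; rewrite compmA => gu; have [h Eh] := coker_fact kf gu.
  by exists (h \oc b); apply: ea; rewrite Eh !compmA.
Qed.

Lemma to_zero Z X (f : hom X Z) : is_zero Z -> f = 0.
Proof. by move=> /(_ X)[z _]. Qed.

Lemma from_zero Z X (f : hom Z X) : is_zero Z -> f = 0.
Proof. by move=> /(_ X)[_ z]. Qed.

Lemma is_zero_idm Z : is_zero Z -> idm Z = 0.
Proof. by move=> /(_ Z)[z _]. Qed.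

Lemma is_zero_iso X Y (f : hom X Y) : iso f -> is_zero X -> is_zero Y.
Proof.
move=> [g [_ fg]] zX; apply: zero_id0.
by rewrite -fg -[f]compm1 (is_zero_idm zX) compm0 comp0m.
Qed.

(** A mono is a kernel, and if it is also epi it is the kernel of 0. *)
Lemma mono_epi_iso (hA : abelian A) X Y (f : hom X Y) : mono f -> epi f -> iso f.
Proof.
move=> mf ef; have [Z [g kf]] := ab_mono hA mf.
have g0 : g = 0 by apply: (epi0 ef); rewrite kf.1.
have [|h Eh] := ker_fact (g := idm Y) kf; first by rewrite g0 comp0m.
exists h; split=> //; apply: mf.
by rewrite compmA -Eh comp1m compm1.
Qed.

(** The image of f is a subobject of S, hence zero or all of S. *)
Lemma to_simple_eq0_or_epi (hA : abelian A) X S (f : hom X S) :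
  simple S -> f = 0 \/ epi f.
Proof.
move=> [_ sS]; have [I [e [i [R [r [ee fE _ [ki _]]]]]]] := image_fact hA f.
have mi := ker_mono ki; have [zI|ii] := sS I i mi; rewrite fE.
  by left; rewrite (to_zero e zI) compm0.
by right; apply: epi_comp => //; apply: iso_epi.
Qed.

Lemma finite_length_iso X Y (f : hom X Y) :
  iso f -> finite_length X -> finite_length Y.
Proof.
move=> fi flX; case: flX f fi => [Z zZ|X' {}X S i p [ki cp] sS flX'] f fi.
  exact/FiniteLength0/(is_zero_iso fi).
have [g [gf fg]] := fi.
apply: (FiniteLengthS (i := f \oc i) (p := p \oc g)) sS flX'; split.
- apply: (@is_kernel_iso _ _ _ _ _ f (idm S)) => //.
    exact: idm_mono.
  by rewrite -compmA gf compm1 comp1m.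
- apply: (@is_cokernel_iso _ _ _ _ _ (idm X') g); first exact: idm_epi.
    by exists f.
  by rewrite compm1 compmA gf comp1m.
Qed.

End Categories.

(** * The canonical functor to the quotient category *)

Section Quotient.
Context {k : fieldType} {A : klinear_category k} (C : A -> Prop).
Context (hA : abelian A) (hC : serre C).
Implicit Types X Y Z W M N S : A.

Local Notation Q := (serre_quotient hA hC).

(** The canonical functor on morphisms, with values typed as morphisms of Q
    so that the notations and lemmas on categories apply. *)
Definition quo X Y (f : hom X Y) : @hom k Q X Y := qmor hA hC f.

Lemma quo_id X : quo (idm X) = @idm k Q X.
Proof. by []. Qed.

Lemma quo_comp X Y Z (g : hom Y Z) (f : hom X Y) :
  quo (g \oc f) = quo g \oc quo f.
Proof. exact: qmor_comp. Qed.

Lemma quo_linear X Y : linear (@quo X Y).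
Proof. by move=> a f g; apply: qmorP. Qed.

Lemma quoD X Y (f g : hom X Y) : quo (f + g) = quo f + quo g.
Proof. by have := quo_linear 1 f g; rewrite !scale1r. Qed.

Lemma quo0 X Y : quo (0 : hom X Y) = 0.
Proof. by apply: (addrI (quo 0)); rewrite -quoD !addr0. Qed.

(** The bridge between germs and the category: a germ (s, y) of p says that p
    is the fraction with denominator quo s and numerator quo y. *)
Lemma quo_germ M N (p : @hom k Q M N) X (s : hom X M) (y : hom X N) :
  qgerm p s y -> p \oc quo s = quo y.
Proof.
move=> gp; have ci : cepi C (idm X) by apply: (epi_cepi hC); apply: idm_epi.
have quo_germ_id Z (f : hom X Z) : qgerm (quo f) (idm X) f.
  by rewrite -{2}[f]compm1; apply: qgerm_mor.
exact: (qgerm_inj ci (qgerm_qcomp (quo_germ_id _ s) gp) (quo_germ_id _ y)).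
Qed.

(** Existence of right fractions p = T y / T t, where T t is epi (quo_epi) but
    not always invertible. *)
Lemma quo_presentation M N (p : @hom k Q M N) :
  exists X (t : hom X M) (y : hom X N), cepi C t /\ p \oc quo t = quo y.
Proof.
by have [X [t [y [ct /quo_germ gp]]]] := qgerm_ex p; exists X, t, y.
Qed.

Lemma quo_eq0_local X Y (f : hom X Y) : quo f = 0 ->
  exists W (t : hom W X), cepi C t /\ f \oc t = 0.
Proof.
move=> f0; have gf := qgerm_mor hA hC f (idm X).
have := qgerm_mor hA hC (0 : hom X Y) (idm X).
rewrite -[qmor _ _ _]/(quo 0) quo0 -f0 comp0m.
rewrite compm1 -[qmor _ _ _]/(quo f) in gf; move: gf.
have [g ->] := qclass_ex (quo f).
move=> /qgermE gf /qgermE g0; have [W [t [ct E]]] := germ_fun hA hC gf g0.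
by exists W, t; rewrite E comp0m.
Qed.

(** If q kills T s, then a germ (s t, y) of q has T y = 0, so y vanishes along
    some r and q has the zero germ (s t r, 0). *)
Lemma quo_epi X Y (s : hom X Y) : cepi C s -> epi (quo s).
Proof.
move=> cs; apply: epiP => N q qs.
have [X' [t [y [ct gq]]]] := qgerm_total q s.
have : quo y = 0 by rewrite -(quo_germ gq) quo_comp compmA qs comp0m.
case/quo_eq0_local => W [r [cr yr]]; have := qgerm_comp r gq; rewrite yr => gq0.
apply: (qgerm_inj _ gq0); first by do !apply: (cepi_comp hA hC).
rewrite -(comp0m _ (s \oc t \oc r)) -(quo0 Y N); exact: qgerm_mor.
Qed.

(** T kills f only if its image is in C: f vanishes along a C-epimorphism, and
    then so does the epi part of f. *)
Lemma quo_eq0_image X Y (f : hom X Y) : quo f = 0 ->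
  forall I (e : hom X I) (i : hom I Y), epi e -> mono i -> f = i \oc e -> C I.
Proof.
case/quo_eq0_local => W [t [ct ft]] I e i ee mi fE; apply: (ct _ e ee).
by apply: (mono0 mi); rewrite compmA -fE.
Qed.

Lemma quo_zero X : C X -> @is_zero k Q X.
Proof.
move=> CX; apply: zero_id0; rewrite -quo_id.
have c0 : cepi C (0 : hom X X).
  by move=> W w ew _; apply: (serre_quo hC ew).
by apply: (epi0 (quo_epi c0)); rewrite quo0 compm0.
Qed.

Lemma zero_quo X : @is_zero k Q X -> C X.
Proof.
move=> /is_zero_idm; rewrite -quo_id => X0.
by apply: (quo_eq0_image X0 (e := idm X) (i := idm X));
  rewrite ?comp1m //; [apply: idm_epi|apply: idm_mono].
Qed.

Lemma quo_factor_eq0 X Y Z (g : hom Y Z) (f : hom X Y) : C Y -> quo (g \oc f) = 0.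
Proof.
move=> CY; rewrite quo_comp.
by rewrite (to_zero (quo f) (quo_zero CY)) compm0.
Qed.

(** If T s kills p = T y / T t, then s y vanishes along some C-epimorphism r, so
    y r factors through the kernel of s, which becomes zero in Q. *)
Lemma quo_mono X Y (s : hom X Y) : cmono C s -> mono (quo s).
Proof.
move=> cs; apply: monoP => M p sp.
have [X' [t [y [ct pE]]]] := quo_presentation p.
have : quo (s \oc y) = 0 by rewrite quo_comp -pE compmA sp comp0m.
case/quo_eq0_local => W [r [cr syr]].
have [K [l kl]] := ab_kernel hA s.
have CK : C K by apply: (cs _ l (ker_mono kl) kl.1).
have [|h Eh] := ker_fact (g := y \oc r) kl; first by rewrite compmA.
apply: (epi0 (quo_epi (cepi_comp hA hC ct cr))).
by rewrite quo_comp compmA pE -quo_comp Eh quo_factor_eq0.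
Qed.

Lemma epi_quo X Y (f : hom X Y) : epi (quo f) -> cepi C f.
Proof.
move=> ef W w ew wf.
have w0 : quo w = 0 by apply: (epi0 ef); rewrite -quo_comp wf quo0.
apply: (quo_eq0_image w0 ew (i := idm W)); last by rewrite comp1m.
exact: idm_mono.
Qed.

Lemma mono_quo X Y (f : hom X Y) : mono (quo f) -> cmono C f.
Proof.
move=> mf W w mw fw.
have w0 : quo w = 0 by apply: (mono0 mf); rewrite -quo_comp fw quo0.
apply: (quo_eq0_image w0 (e := idm W) _ mw); last by rewrite compm1.
exact: idm_epi.
Qed.

(** The image K of ker s under y is in C, because T kills y on ker s. So y
    descends to a map from the image of s, a subobject of M with quotient in C,
    to N / K, and that is a morphism of Q. *)
Lemma quo_descent X M N (s : hom X M) (y : hom X N) : cepi C s ->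
  (forall W (w : hom W X), s \oc w = 0 -> quo (y \oc w) = 0) ->
  exists p : @hom k Q M N, p \oc quo s = quo y.
Proof.
move=> cs sy; have [L [l kl]] := ab_kernel hA s.
have [K [e [ee yl _]]] := image_sub hA (y \oc l).
have CK : C (so_obj K).
  by apply: (quo_eq0_image (sy _ _ kl.1) ee _ yl); apply: ker_mono (so_exact K).1.
have [|h [x [ex Ex Eh]]] := frac_make hA (y := y) cs CK.
  move=> Y t /(ker_fact kl)[t' ->].
  by rewrite [y \oc _]compmA yl -compmA compmA (so_exact K).1.1 comp0m.
exists (qclass hA hC h); apply: quo_germ.
by apply/qgermE; rewrite -Ex; apply/(graph_germ hC)/graph_map.
Qed.

Lemma quo_iso X Y (f : hom X Y) : cmono C f -> cepi C f -> iso (quo f).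
Proof.
move=> mf ef; have [|g gf] := quo_descent (y := idm X) ef.
  move=> W w fw; rewrite comp1m; apply: (mono0 (quo_mono mf)).
  by rewrite -quo_comp fw quo0.
exists g; split=> //; apply: (quo_epi ef).
by rewrite -compmA gf quo_id compm1 comp1m.
Qed.

(** A morphism p = T y / T t with T f p = 0 has f y vanishing along some r, so
    that y r = i h; then h / (t r) descends to the factorization of p. *)
Lemma quo_kernel X Y K (f : hom X Y) (i : hom K X) :
  is_kernel f i -> is_kernel (quo f) (quo i).
Proof.
move=> ki; have mi := quo_mono (mono_cmono hC (ker_mono ki)).
apply: kerI => //; first by rewrite -quo_comp ki.1 quo0.
move=> W p fp; have [V [t [y [ct pE]]]] := quo_presentation p.
have : quo (f \oc y) = 0 by rewrite quo_comp -pE compmA fp comp0m.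
case/quo_eq0_local => U [r [cr fyr]].
have [|h Eh] := ker_fact (g := y \oc r) ki; first by rewrite compmA.
have ctr := cepi_comp hA hC ct cr.
have [|q qE] := quo_descent (y := h) ctr.
  move=> V' w trw; apply: (mono0 mi); rewrite -quo_comp compmA -Eh.
  by rewrite -compmA quo_comp -pE -compmA -quo_comp compmA trw quo0 compm0.
exists q; apply: (quo_epi ctr); rewrite -compmA qE.
by rewrite quo_comp compmA pE -!quo_comp Eh.
Qed.

(** For p = T y / T t with p T f = 0, the candidate factorization is the fraction
    y / (c t). It is well defined because a map w killed by c t has t w landing in
    the image of f, where p vanishes; a pullback lifts t w to the source of f. *)
Lemma quo_cokernel X Y Z (f : hom X Y) (c : hom Y Z) :
  is_cokernel f c -> is_cokernel (quo f) (quo c).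
Proof.
move=> kc; have ec := epi_cepi hC (coker_epi kc).
apply: cokerI; [exact: quo_epi|by rewrite -quo_comp kc.1 quo0|].
move=> W p pf; have [V [t [y [ct pE]]]] := quo_presentation p.
have [|q qE] := quo_descent (y := y) (cepi_comp hA hC ec ct); last first.
  by exists q; apply: (quo_epi ct); rewrite pE -qE -compmA quo_comp.
move=> U w ctw.
have [I [e [i [R [r [ee fE cr [ki _]]]]]]] := image_fact hA f.
have [c' cE] := coker_fact cr kc.1.
have [r' rE] := coker_fact kc cr.1.
have [|a aE] := ker_fact (g := t \oc w) ki.
  by rewrite rE -compmA [c \oc _]compmA ctw compm0.
have [P [b [a' [eb ea' _]]]] := pullback_epi hA a ee.
apply: (epi0 (quo_epi (epi_cepi hC eb))).
rewrite -quo_comp -compmA quo_comp -pE -compmA -quo_comp compmA aE -compmA -ea'.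
by rewrite compmA -fE quo_comp compmA pf comp0m.
Qed.

Lemma quo_short_exact X Y Z (i : hom X Y) (p : hom Y Z) :
  short_exact i p -> short_exact (quo i) (quo p).
Proof. by move=> [ki cp]; split; [apply: quo_kernel|apply: quo_cokernel]. Qed.

(** The inclusion and the projection of an index become invertible in Q. *)
Lemma quo_arrow M N (p : @hom k Q M N) :
  exists M' N' (a : @hom k Q M' M) (b : @hom k Q N N') (f : hom M' N'),
    [/\ iso a, iso b & b \oc (p \oc a) = quo f].
Proof.
have [f ->] := qclass_ex p.
exists (qi_src f), (qi_tgt f), (quo (qi_in f)), (quo (qi_pr f)), (fr_map f); split.
- apply: quo_iso; last exact: qi_in_cepi.
  exact/(mono_cmono hC)/qi_in_mono.
- apply: quo_iso; first exact: qi_pr_cmono.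
  exact/(epi_cepi hC)/qi_pr_epi.
- exact: qclass_mor.
Qed.

(** Factor f = i e through its image: T e is invertible because e is a
    C-monomorphism, and i is the kernel of its cokernel. *)
Lemma quo_normal_mono M N (f : hom M N) :
  mono (quo f) -> exists Z (g : hom N Z), is_kernel (quo g) (quo f).
Proof.
move=> /mono_quo mf.
have [I [e [i [R [r [ee fE cr [ki ci]]]]]]] := image_fact hA f.
have ie : iso (quo e).
  apply: quo_iso; last exact: epi_cepi.
  by move=> W w mw ew; apply: (mf _ w mw); rewrite fE -compmA ew compm0.
exists R, r; have [e' [e'e ee']] := ie.
rewrite -[quo r]compm1; apply: (kernel_arrow_iso (a := e')).
- by exists (quo e).
- exact: idm_mono.
- by rewrite fE quo_comp comp1m -compmA ee' compm1; apply: quo_kernel.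
Qed.

Lemma quo_normal_epi M N (f : hom M N) :
  epi (quo f) -> exists Z (g : hom Z M), is_cokernel (quo g) (quo f).
Proof.
move=> /epi_quo ef.
have [I [e [i [R [r [ee fE cr [ki ci]]]]]]] := image_fact hA f.
have ii : iso (quo i).
  apply: quo_iso; first exact/(mono_cmono hC)/ker_mono/ki.
  by move=> W w ew wi; apply: (ef _ w ew); rewrite fE compmA wi comp0m.
have [K [j kj]] := ab_kernel hA e.
exists K, j; have [i' [i'i ii']] := ii.
rewrite -[quo j]comp1m; apply: (cokernel_arrow_iso (b := i')).
- exact: idm_epi.
- by exists (quo i).
- rewrite fE quo_comp compm1 compmA i'i comp1m.
  exact/quo_cokernel/epi_coker/kj.
Qed.

Theorem serre_quotient_abelian : abelian Q.
Proof.
split.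
- have [Z zZ] := ab_zero hA; exists Z; apply: quo_zero.
  exact: serre_zero hC _ zZ.
- move=> X Y.
  have [B [i1 [i2 [p1 [p2 [b11 b22 b12 b21 bE]]]]]] := ab_biproduct hA X Y.
  exists B, (quo i1), (quo i2), (quo p1), (quo p2).
  split; rewrite -!quo_comp -?quoD ?(b11, b22, b12, b21, bE) //; exact: quo0.
- move=> X Y p; have [M [N [a [b [f [ia ib E]]]]]] := quo_arrow p.
  have [K [i ki]] := ab_kernel hA f; exists K, (a \oc quo i).
  apply: (is_kernel_iso ia (iso_mono ib)); rewrite E; exact: quo_kernel.
- move=> X Y p; have [M [N [a [b [f [ia ib E]]]]]] := quo_arrow p.
  have [R [c kc]] := ab_cokernel hA f; exists R, (quo c \oc b).
  apply: (is_cokernel_iso (iso_epi ia) ib); rewrite E; exact: quo_cokernel.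
- move=> X Y p mp; have [M [N [a [b [f [ia ib E]]]]]] := quo_arrow p.
  have mf : mono (quo f) by rewrite -E; do !apply: mono_comp => //; apply: iso_mono.
  have [Z [g kg]] := quo_normal_mono mf; exists Z, (quo g \oc b).
  by apply: (kernel_arrow_iso ia (iso_mono ib)); rewrite E.
- move=> X Y p mp; have [M [N [a [b [f [ia ib E]]]]]] := quo_arrow p.
  have mf : epi (quo f) by rewrite -E; do !apply: epi_comp => //; apply: iso_epi.
  have [Z [g kg]] := quo_normal_epi mf; exists Z, (a \oc quo g).
  by apply: (cokernel_arrow_iso (iso_epi ia) ib); rewrite E.
Qed.

Lemma quo_simple S : simple S -> ~ C S -> @simple k Q S.
Proof.
move=> sS nCS; split; first by move/zero_quo.
move=> Y p mp; have [X [t [y [ct pE]]]] := quo_presentation p.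
have [y0|ey] := to_simple_eq0_or_epi hA y sS; [left|right].
  have p0 : p = 0 by apply: (epi0 (quo_epi ct)); rewrite pE y0 quo0.
  by apply: zero_id0; apply: mp; rewrite p0 !comp0m.
apply: (mono_epi_iso serre_quotient_abelian) => //.
apply: (@epi_compr _ _ _ _ _ _ (quo t)); rewrite pE.
exact/quo_epi/(epi_cepi hC).
Qed.

Lemma quo_finite_length X : finite_length X -> @finite_length k Q X.
Proof.
elim=> {X} [Z zZ|X Y S i p ip sS _ IHX].
  exact/FiniteLength0/quo_zero/(serre_zero hC).
(* If S is in C, the sequence only says that T i is invertible. *)
have [CS|nCS] := pselect (C S); last first.
  exact: (FiniteLengthS (quo_short_exact ip) (quo_simple sS nCS) IHX).
apply: finite_length_iso IHX; apply: (quo_iso (f := i)).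
  exact/(mono_cmono hC)/ker_mono/ip.1.
exact: (ses_cepi hA hC ip CS).
Qed.

(** Let S and S' be simple and not in C, and p = T y / T t. Then t is nonzero,
    hence epi; and y maps ker t to a subobject of S' lying in C, that is to zero,
    so y already factors through t in A. *)
Lemma quo_full_simple S S' : simple S -> simple S' ->
  forall p : @hom k Q S S', exists f : hom S S', p = quo f.
Proof.
move=> sS sS' p.
have [CS|nCS] := pselect (C S).
  by exists 0; rewrite quo0; apply/from_zero/quo_zero.
have [X [t [y [ct pE]]]] := quo_presentation p.
have [t0|et] := to_simple_eq0_or_epi hA t sS.
  case: nCS; apply: (ct _ (idm S)); first exact: idm_epi.
  by rewrite t0 compm0.
have [L [l kl]] := ab_kernel hA t.
have yl0 : quo (y \oc l) = 0.
  by rewrite quo_comp -pE -compmA -quo_comp kl.1 quo0 compm0.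
have [yl|eyl] := to_simple_eq0_or_epi hA (y \oc l) sS'.
  have [f fE] := coker_fact (epi_coker hA et kl) yl.
  by exists f; apply: (quo_epi ct); rewrite pE fE quo_comp.
exists 0; rewrite quo0; have CS' : C S'.
  apply: (quo_eq0_image yl0 eyl (i := idm S')); last by rewrite comp1m.
  exact: idm_mono.
exact/to_zero/quo_zero.
Qed.

(** Dévissage of the target, by the left exact sequence
    0 -> Hom(S, X) -> Hom(S, Y) -> Hom(S, S'). *)
Lemma quo_hom_simple S N : (forall X Y : A, finite_dimensional (hom X Y)) ->
  simple S -> finite_length N -> finite_dimensional (@hom k Q S N).
Proof.
move=> fdA sS; elim=> {N} [Z zZ|X Y S' i p ip sS' _ IHX].
  apply: finite_dimensional_eq0 => f.
  exact/to_zero/quo_zero/(serre_zero hC).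
have fdS' : finite_dimensional (@hom k Q S S').
  apply: (finite_dimensional_surj (@quo_linear S S') (fdA S S')).
  exact: quo_full_simple.
apply: (finite_dimensional_exact (compm_linear (quo i)) (compm_linear (quo p))
  IHX fdS').
move=> f; exact: (ker_fact (quo_kernel ip.1)).
Qed.

(** Dévissage of the source, by the left exact sequence
    0 -> Hom(S, N) -> Hom(Y, N) -> Hom(X, N). *)
Lemma quo_hom M N : (forall X Y : A, finite_dimensional (hom X Y)) ->
  finite_length M -> finite_length N -> finite_dimensional (@hom k Q M N).
Proof.
move=> fdA flM flN; elim: flM => {M} [Z zZ|X Y S i p ip sS _ IHX].
  apply: finite_dimensional_eq0 => f.
  exact/from_zero/quo_zero/(serre_zero hC).
have fdS := quo_hom_simple fdA sS flN.
apply: (finite_dimensional_exact (precompm_linear (quo p))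
  (precompm_linear (quo i)) fdS IHX).
move=> f; exact: (coker_fact (quo_cokernel ip.2)).
Qed.

End Quotient.

Theorem proposition3p4 (k : closedFieldType) (A : klinear_category k)
    (C : A -> Prop) (hA : abelian A) (hAf : locally_finite A) (hC : serre C) :
  abelian (serre_quotient hA hC) /\ locally_finite (serre_quotient hA hC).
Proof.
split; first exact: serre_quotient_abelian.
split=> [X Y|X]; last exact/quo_finite_length/lf_length.
exact: quo_hom (lf_hom hAf) (lf_length hAf X) (lf_length hAf Y).
Qed.
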